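(* Let $G$ be a locally dual polar graph. Then the $1$--skeleton $\widetilde G$ of the universal cover of the triangle-square complex of $G$ is a dual polar graph. If, moreover, $G$ is locally finite, then $\widetilde G$ is a finite dual polar graph.
   Context: Graphs are simple, undirected, connected, possibly infinite; $d$ is graph distance, $I(u,v)=\{x:d(u,x)+d(x,v)=d(u,v)\}$. $G$ is thick if for every $u,v$ with $d(u,v)=2$ the interval $I(u,v)$ contains an induced $4$--cycle. Locally weakly modular: for every $u$, (LTC) for adjacent $v,w$ with $d(u,v)=d(u,w)=2$ there is a common neighbor of $u,v,w$, and (LQC) for $v,w,z$ with $z\sim v,w$, $d(v,w)=d(u,v)=d(u,w)=d(u,z)-1=2$ there is a common neighbor of $u,v,w$. A graph is locally dual polar if it is thick, locally weakly modular, and contains no induced $K_4^-$ and no isometric $K_{3,3}^-$ ($K_4$, resp. $K_{3,3}$, minus an edge). A subgraph is gated if each vertex $x$ has $x'$ in it with $x'\in I(x,y)$ for all $y$ in it; the gated hull is the smallest gated set containing a given set. A dual polar graph is a graph in which (A1) every maximal clique is gated; (A3\&4) the gated hull of two vertices at distance $2$ has diameter $2$; (A5) for nonadjacent $u,v$ and any neighbor $x$ of $u$ in $I(u,v)$ there is a neighbor $y$ of $v$ in $I(u,v)$ with $d(u,v)=d(x,y)=d(u,y)+1=d(x,v)+1$. The triangle-square complex is the $2$--complex with $1$--skeleton $G$ and $2$--cells glued along all $3$--cycles and induced $4$--cycles; the universal cover is its simply connected covering space. *)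

(* Defs.v *)
From Stdlib Require Import List Relations Arith.
Import ListNotations.
Set Implicit Arguments.

Section Graphs.
Variable T : Type.
Variable adj : T -> T -> Prop.

Inductive walkn : T -> T -> nat -> Prop :=
| walkn0 x : walkn x x 0
| walknS x y z n : adj x y -> walkn y z n -> walkn x z (S n).

Definition dist_is (u v : T) (n : nat) : Prop :=
  walkn u v n /\ forall m, walkn u v m -> n <= m.

Definition is_graph : Prop :=
  (forall x y, adj x y -> adj y x) /\ (forall x, ~ adj x x) /\
  (forall u v, exists n, walkn u v n).

Definition in_interval (u v x : T) : Prop :=
  exists a c, dist_is u x a /\ dist_is x v c /\ dist_is u v (a + c).

Definition induced_C4 (a b c d : T) : Prop :=
  a <> b /\ a <> c /\ a <> d /\ b <> c /\ b <> d /\ c <> d /\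
  adj a b /\ adj b c /\ adj c d /\ adj d a /\ ~ adj a c /\ ~ adj b d.

Definition thick : Prop :=
  forall u v, dist_is u v 2 ->
    exists a b c d, induced_C4 a b c d /\
      in_interval u v a /\ in_interval u v b /\
      in_interval u v c /\ in_interval u v d.

Definition LTC (u : T) : Prop :=
  forall v w, adj v w -> dist_is u v 2 -> dist_is u w 2 ->
    exists x, adj x u /\ adj x v /\ adj x w.

Definition LQC (u : T) : Prop :=
  forall v w z, adj z v -> adj z w ->
    dist_is v w 2 -> dist_is u v 2 -> dist_is u w 2 -> dist_is u z 3 ->
    exists x, adj x u /\ adj x v /\ adj x w.

Definition locally_weakly_modular : Prop := forall u, LTC u /\ LQC u.

Definition no_induced_K4minus : Prop :=
  ~ exists a b c d,
      a <> b /\ a <> c /\ a <> d /\ b <> c /\ b <> d /\ c <> d /\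
      adj a b /\ adj a c /\ adj a d /\ adj b c /\ adj b d /\ ~ adj c d.

(* no isometric K_{3,3} minus an edge (the missing edge is a3-b3):
   the six vertices realise in G exactly the distances of K_{3,3}^- *)
Definition no_isometric_K33minus : Prop :=
  ~ exists a1 a2 a3 b1 b2 b3,
      dist_is a1 b1 1 /\ dist_is a1 b2 1 /\ dist_is a1 b3 1 /\
      dist_is a2 b1 1 /\ dist_is a2 b2 1 /\ dist_is a2 b3 1 /\
      dist_is a3 b1 1 /\ dist_is a3 b2 1 /\ dist_is a3 b3 3 /\
      dist_is a1 a2 2 /\ dist_is a1 a3 2 /\ dist_is a2 a3 2 /\
      dist_is b1 b2 2 /\ dist_is b1 b3 2 /\ dist_is b2 b3 2.

Definition locally_dual_polar : Prop :=
  thick /\ locally_weakly_modular /\ no_induced_K4minus /\ no_isometric_K33minus.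

Definition locally_finite : Prop :=
  forall x, exists l : list T, forall y, adj x y -> In y l.

Definition gated (S : T -> Prop) : Prop :=
  forall x, exists x', S x' /\ forall y, S y -> in_interval x y x'.

Definition is_gated_hull (A S : T -> Prop) : Prop :=
  gated S /\ (forall x, A x -> S x) /\
  (forall S', gated S' -> (forall x, A x -> S' x) -> forall x, S x -> S' x).

Definition diam_is (S : T -> Prop) (n : nat) : Prop :=
  (forall x y, S x -> S y -> exists m, m <= n /\ dist_is x y m) /\
  (exists x y, S x /\ S y /\ dist_is x y n).

Definition clique (K : T -> Prop) : Prop :=
  forall x y, K x -> K y -> x <> y -> adj x y.

Definition maximal_clique (K : T -> Prop) : Prop :=
  clique K /\ forall K', clique K' -> (forall x, K x -> K' x) -> forall x, K' x -> K x.

Definition A1 : Prop := forall K, maximal_clique K -> gated K.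

Definition A34 : Prop :=
  forall u v, dist_is u v 2 ->
    exists H, is_gated_hull (fun x => x = u \/ x = v) H /\ diam_is H 2.

Definition A5 : Prop :=
  forall u v x n, ~ adj u v -> dist_is u v n -> adj u x -> in_interval u v x ->
    exists y m, adj v y /\ in_interval u v y /\
      dist_is x y n /\ dist_is u y m /\ dist_is x v m /\ n = S m.

Definition dual_polar : Prop := is_graph /\ A1 /\ A34 /\ A5.

Inductive is_walk : list T -> Prop :=
| is_walk1 x : is_walk [x]
| is_walkS x y l : adj x y -> is_walk (y :: l) -> is_walk (x :: y :: l).

(* elementary homotopies of edge paths across the 2-cells:
   backtracking, triangles (3-cycles) and induced 4-cycles *)
Inductive ts_move : list T -> list T -> Prop :=
| mv_back pre suf x y : adj x y ->
    ts_move (pre ++ x :: y :: x :: suf) (pre ++ x :: suf)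
| mv_tri pre suf x y z : adj x y -> adj y z -> adj x z ->
    ts_move (pre ++ x :: y :: z :: suf) (pre ++ x :: z :: suf)
| mv_sq pre suf x y z w : induced_C4 x y z w ->
    ts_move (pre ++ x :: y :: z :: suf) (pre ++ x :: w :: z :: suf).

Definition ts_homotopic : list T -> list T -> Prop :=
  clos_refl_sym_trans (list T) ts_move.

(* vertices of the universal cover (base point b): homotopy classes of walks from b *)
Definition cover_vertex (b : T) : Type :=
  { S : list T -> Prop |
      exists p, is_walk p /\ hd_error p = Some b /\
                forall q, S q <-> ts_homotopic p q }.

Definition cover_adj (b : T) (S S' : cover_vertex b) : Prop :=
  exists p y, proj1_sig S p /\ adj (last p b) y /\ proj1_sig S' (p ++ [y]).

End Graphs.

(* Main.v *)
(** Fix a base point [b]. Walks from [b] are sorted into levels: a walk of level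
    [n] is prolonged by a neighbour [z] of its end that lies on no line through
    the end and a lower neighbour, and two prolongations by the same [z] are
    identified when they start from the same vertex or from vertices with a common
    lower neighbour. (LTC), (LQC) and the absence of [K_4^-] make this an
    equivalence relation, and the classes form a graph that covers [G] and to which
    triangles and squares lift. Hence homotopic walks lift to the same class, the
    classes are the vertices of the universal cover, and the level is the distance
    from the base point. The triangle and quadrangle conditions at [b] are then
    built into the construction, and changing [b] gives them at every vertex.

    In the cover, maximal cliques (lines) are gated by the triangle condition.
    Thickness and the absence of isometric [K_{3,3}^-] show that two lines through
    a vertex determine the other lines of a quad through it, so that quads do not
    depend on the vertex they are drawn from. They therefore have diameter 2 and
    are closed under common neighbours, hence gated; (A5) follows by induction from
    the gates of quads. By (A5), a vertex at distance [n] from [u] is approached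
    from [u] through at least [n] neighbours of [u], which bounds the diameter of a
    locally finite cover. *)

Require Import Defs.
From Stdlib Require Import List Arith Lia Relations Classical.
From Stdlib Require Import FunctionalExtensionality PropExtensionality ProofIrrelevance.
From Stdlib Require Import IndefiniteDescription.
Import ListNotations.

(** * Small graph distances in terms of edges *)

Section Distances.

Variable T : Type.
Variable adj : T -> T -> Prop.
Hypothesis adj_irr : forall x, ~ adj x x.

Lemma walkn_cons {u v w n} : adj u v -> walkn adj v w n -> walkn adj u w (S n).
Proof. econstructor; eassumption. Qed.

Lemma walkn_snoc u v w n : walkn adj u v n -> adj v w -> walkn adj u w (S n).
Proof.
  induction 1 as [x | x y z n H _ IH]; intro A.
  - econstructor; [exact A | constructor].
  - econstructor; [exact H | auto].
Qed.

Lemma dist_is_unique u v n m : dist_is adj u v n -> dist_is adj u v m -> n = m.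
Proof. intros [H1 H2] [H3 H4]. apply Nat.le_antisymm; auto. Qed.

Lemma dist_is_0 u v : dist_is adj u v 0 <-> u = v.
Proof.
  split.
  - intros [H _]; inversion H; reflexivity.
  - intros <-; split; [constructor | intros; lia].
Qed.

Lemma dist_is_1 u v : dist_is adj u v 1 <-> adj u v.
Proof.
  split.
  - intros [H _]; inversion H as [|? y ? ? A W]; subst; inversion W; subst; exact A.
  - intro A; split; [econstructor; [exact A | constructor]|].
    intros [|m] W; [|lia]. inversion W; subst; exfalso; eapply adj_irr; exact A.
Qed.

Lemma dist_is_2 u v : dist_is adj u v 2 <->
  u <> v /\ ~ adj u v /\ exists c, adj u c /\ adj c v.
Proof.
  split.
  - intros [W M]; split; [|split].
    + intros <-. specialize (M 0 (walkn0 adj _)); lia.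
    + intro A. specialize (M 1 (walkn_cons A (walkn0 adj _))); lia.
    + inversion W as [|? y ? ? A W']; subst.
      inversion W' as [|? y' ? ? A' W'']; subst; inversion W''; subst; eauto.
  - intros (N & NA & c & A & B); split.
    + econstructor; [exact A|]. econstructor; [exact B | constructor].
    + intros [|[|m]] W; [| |lia].
      * inversion W; congruence.
      * inversion W as [|? y ? ? A' W']; subst; inversion W'; subst; contradiction.
Qed.

Lemma dist_is_3 u v : dist_is adj u v 3 <->
  u <> v /\ ~ adj u v /\ (forall c, adj u c -> adj c v -> False) /\
  exists c d, adj u c /\ adj c d /\ adj d v.
Proof.
  split.
  - intros [W M]; split; [|split; [|split]].
    + intros <-. specialize (M 0 (walkn0 adj _)); lia.
    + intro A. specialize (M 1 (walkn_cons A (walkn0 adj _))); lia.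
    + intros c A B. specialize (M 2 (walkn_cons A (walkn_cons B (walkn0 adj _)))); lia.
    + inversion W as [|? c ? ? A W1]; subst; inversion W1 as [|? d ? ? B W2]; subst.
      inversion W2 as [|? e ? ? C W3]; subst; inversion W3; subst; eauto.
  - intros (N & NA & NC & c & d & A & B & C); split.
    + exact (walkn_cons A (walkn_cons B (walkn_cons C (walkn0 adj _)))).
    + intros [|[|[|m]]] W; [| | |lia].
      * inversion W; congruence.
      * inversion W as [|? y ? ? A' W']; subst; inversion W'; subst; contradiction.
      * inversion W as [|? y ? ? A' W']; subst; inversion W' as [|? y' ? ? B' W2]; subst.
        inversion W2; subst; exfalso; eauto.
Qed.

End Distances.

(** * The covering graph built from the local conditions *)

Section LocallyWeaklyModular.


Variable T : Type.
Variable adj : T -> T -> Prop.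
Hypothesis adj_sym : forall x y, adj x y -> adj y x.
Hypothesis adj_irr : forall x, ~ adj x x.
(** This is the absence of an induced [K_4^-]: an edge together with its common neighbours is a
    clique, so each edge lies in exactly one line. *)
Hypothesis line_unique : forall x y a c,
  adj x y -> adj a x -> adj a y -> adj c x -> adj c y -> a <> c -> adj a c.
Hypothesis ltc : forall u v w p q, adj v w -> u <> v -> u <> w ->
  ~ adj u v -> ~ adj u w -> adj u p -> adj p v -> adj u q -> adj q w ->
  exists x, adj x u /\ adj x v /\ adj x w.
Hypothesis lqc : forall u v w z p q, adj z v -> adj z w -> v <> w -> ~ adj v w ->
  u <> v -> ~ adj u v -> u <> w -> ~ adj u w ->
  adj u p -> adj p v -> adj u q -> adj q w ->
  u <> z -> ~ adj u z -> (forall c, adj u c -> adj c z -> False) ->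
  exists x, adj x u /\ adj x v /\ adj x w.

(** * Levels *)

Section Levels.

Variable b : T.

Notation tip p := (hd b p).

(* Walks are stored backwards: the head of the list is the end of the walk and its
   last element is [b]. [low_of n R p r]: [r] is a neighbour of [p] one level
   below; at level 0 the test [n <> 0] excludes [r = []], which [tip] would
   otherwise read as [b]. *)
Definition low_of (n : nat) (R : list T -> list T -> Prop) (p r : list T) : Prop :=
  n <> 0 /\ R (tip p :: r) p.

Definition rise_of (n : nat) (R : list T -> list T -> Prop) (p : list T) (z : T) : Prop :=
  R p p /\ adj (tip p) z /\
  forall r, low_of n R p r -> tip r <> z /\ ~ adj (tip r) z.

(** Reflexivity holds only for walks that are built level by level; [eqv n p p] therefore serves
    throughout as the validity of [p] at level [n]. *)
Fixpoint eqv (n : nat) : list T -> list T -> Prop :=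
  match n with
  | 0 => fun p q => p = [b] /\ q = [b]
  | S m => fun p q => exists z p' q', p = z :: p' /\ q = z :: q' /\
      rise_of m (eqv m) p' z /\ rise_of m (eqv m) q' z /\
      (eqv m p' q' \/ exists r, low_of m (eqv m) p' r /\ low_of m (eqv m) q' r)
  end.

Definition low (n : nat) (p r : list T) : Prop := low_of n (eqv n) p r.
Definition rise (n : nat) (p : list T) (z : T) : Prop := rise_of n (eqv n) p z.

Lemma eqv_cons n z p q : rise n p z -> rise n q z ->
  (eqv n p q \/ exists r, low n p r /\ low n q r) -> eqv (S n) (z :: p) (z :: q).
Proof. intros Hp Hq H; exists z, p, q; auto. Qed.

Lemma eqv_sym n p q : eqv n p q -> eqv n q p.
Proof.
  revert p q; induction n as [|n IH]; intros p q; simpl.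
  - tauto.
  - intros (z & p' & q' & -> & -> & Hp & Hq & [H | (r & H1 & H2)]);
      apply (eqv_cons n z q' p' Hq Hp); [left | right; exists r]; auto.
Qed.

Lemma eqv_cons_inv n z y p q : eqv (S n) (z :: p) (y :: q) ->
  z = y /\ rise n p z /\ rise n q z /\
  (eqv n p q \/ exists r, low n p r /\ low n q r).
Proof.
  intros (t & p' & q' & Ep & Eq & Hp & Hq & H).
  injection Ep as -> ->; injection Eq as -> ->; auto.
Qed.

Lemma eqv_refl_l n p q : eqv n p q -> eqv n p p.
Proof.
  destruct n as [|n]; simpl.
  - tauto.
  - intros (z & p' & q' & -> & -> & Hp & Hq & H).
    apply eqv_cons; auto. left; apply Hp.
Qed.

Lemma eqv_refl_r n p q : eqv n p q -> eqv n q q.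
Proof. intro H; apply eqv_sym in H; eapply eqv_refl_l; eassumption. Qed.

Lemma eqv_tip n p q : eqv n p q -> tip p = tip q.
Proof.
  destruct n as [|n]; simpl.
  - intros [-> ->]; reflexivity.
  - intros (z & p' & q' & -> & -> & _); reflexivity.
Qed.

Lemma rise_valid n p z : rise n p z -> eqv (S n) (z :: p) (z :: p).
Proof. intro H; apply eqv_cons; auto. left; apply H. Qed.

Lemma low_cons n p z : rise n p z -> low (S n) (z :: p) p.
Proof. intro H; split; [discriminate | exact (rise_valid _ _ _ H)]. Qed.

Lemma low_inv n p r : low n p r ->
  exists m, n = S m /\ rise m r (tip p) /\ eqv (S m) (tip p :: r) p.
Proof.
  intros [Hn H]; destruct n as [|m]; [congruence|].
  exists m; repeat split; try exact H;
  apply eqv_refl_l, eqv_cons_inv in H; apply H; assumption.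
Qed.

Lemma low_S m p r : low (S m) p r -> rise m r (tip p).
Proof. intro H; apply low_inv in H as (k & [= <-] & H & _); exact H. Qed.

Lemma low_eqv m p r : low (S m) p r -> eqv (S m) (tip p :: r) p.
Proof. intro H; apply H. Qed.

Lemma low_adj n p r : low n p r -> adj (tip r) (tip p).
Proof. intro H; apply low_inv in H as (m & _ & H & _); apply H. Qed.

Lemma rise_adj n p z : rise n p z -> adj (tip p) z.
Proof. intro H; apply H. Qed.

Lemma rise_low n p z r : rise n p z -> low n p r -> tip r <> z /\ ~ adj (tip r) z.
Proof. intros H; apply H. Qed.

(* Transitivity at level [n + 1] and the lifting of squares [square_at] below it
   are proved by a joint induction; hence the hypotheses on transitivity in the
   lemmas up to [eqv_trans]. *)
Definition transitive_at (n : nat) : Prop :=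
  forall p q r, eqv n p q -> eqv n q r -> eqv n p r.

Lemma low_congr_l n p p' r : transitive_at n ->
  eqv n p p' -> low n p r -> low n p' r.
Proof.
  intros Tr Hp [Hn H]; split; [exact Hn|].
  rewrite <- (eqv_tip _ _ _ Hp); eapply Tr; eassumption.
Qed.

Lemma rise_congr n p p' z : transitive_at n ->
  eqv n p p' -> rise n p z -> rise n p' z.
Proof.
  intros Tr Hp (H1 & H2 & H3); split; [|split].
  - eapply eqv_refl_r; eassumption.
  - rewrite <- (eqv_tip _ _ _ Hp); exact H2.
  - intros r Hr; apply H3.
    apply (low_congr_l n p' p r Tr); [apply eqv_sym; exact Hp | exact Hr].
Qed.

Lemma low_congr_r m p r r' : transitive_at m -> transitive_at (S m) ->
  eqv m r r' -> low (S m) p r -> low (S m) p r'.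
Proof.
  intros Tr TrS Hr H; split; [discriminate|].
  pose proof (low_S _ _ _ H) as Hrise.
  eapply TrS; [|exact (low_eqv _ _ _ H)].
  apply eqv_sym, eqv_cons; auto. eapply rise_congr; eassumption.
Qed.

(** Both prolongations by [tip p] represent [p], so they are equivalent. This is the quadrangle
    condition at the base point. *)
Lemma low_pair m p r r' : transitive_at (S m) ->
  low (S m) p r -> low (S m) p r' ->
  eqv m r r' \/ exists s, low m r s /\ low m r' s.
Proof.
  intros Tr H H'.
  assert (E : eqv (S m) (tip p :: r) (tip p :: r')).
  { eapply Tr; [exact (low_eqv _ _ _ H)|]. apply eqv_sym, low_eqv, H'. }
  apply eqv_cons_inv in E; tauto.
Qed.

Definition square_at (k : nat) : Prop :=
  forall y u w x, low (S k) u y -> rise (S k) u w -> adj (tip y) x -> adj x w ->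
  rise k y x /\ rise (S k) (x :: y) w /\ eqv (S (S k)) (w :: u) (w :: x :: y).

(** The three levels between [tip t] and [w] are visible in $G$ as a distance of at least 3, which
    is what (LQC) asks for. *)
Definition far_at (k : nat) : Prop :=
  forall t y u w, low (S k) y t -> low (S (S k)) u y -> rise (S (S k)) u w ->
  tip t <> w /\ ~ adj (tip t) w /\ forall c, adj (tip t) c -> adj c w -> False.

Lemma square_lower k : transitive_at (S (S k)) -> square_at k ->
  forall t y u x, low (S k) y t -> low (S (S k)) u y ->
  adj (tip t) x -> adj x (tip u) -> low (S (S k)) u (x :: t).
Proof.
  intros Tr Sq t y u x Hy Hu Hx Hxu.
  destruct (Sq t y (tip u) x Hy (low_S _ _ _ Hu) Hx Hxu) as (_ & _ & E).
  split; [discriminate|].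
  eapply Tr; [apply eqv_sym; exact E | exact (low_eqv _ _ _ Hu)].
Qed.

(** A shorter path would give a vertex below [u] that equals [w] or is adjacent to it, against
    [rise]: an edge by lifting a square, a path of length 2 by (LTC) at [tip t] for the edge from
    [tip u] to [w]. *)
Lemma far_of_square k : transitive_at (S (S k)) -> square_at k -> far_at k.
Proof.
  intros Tr Sq t y u w Ht Hy Hw.
  pose proof (low_S _ _ _ Hy) as Ru.
  destruct (rise_low _ _ _ _ Ru Ht) as [Ntu Atu].
  pose proof (rise_adj _ _ _ Hw) as Auw.
  assert (N1 : tip t <> w) by (intros <-; auto).
  assert (N2 : ~ adj (tip t) w).
  { intro H. pose proof (square_lower k Tr Sq t y u w Ht Hy H (adj_sym _ _ Auw)) as L.
    destruct (rise_low _ _ _ _ Hw L) as [N _]; apply N; reflexivity. }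
  split; [exact N1 | split; [exact N2|]].
  intros c Hc Hcw.
  destruct (ltc (tip t) (tip u) w (tip y) c Auw Ntu N1 Atu N2
    (low_adj _ _ _ Ht) (low_adj _ _ _ Hy) Hc Hcw) as (x & X1 & X2 & X3).
  pose proof (square_lower k Tr Sq t y u x Ht Hy (adj_sym _ _ X1) X2) as L.
  destruct (rise_low _ _ _ _ Hw L) as [_ N]; apply N; exact X3.
Qed.

(** A vertex below [x :: y] that is not equivalent to [y] shares a lower neighbour with [y], and
    [far_at], available by induction, keeps it away from [w]. *)
Lemma square_lifts k : (forall m, m <= S k -> transitive_at m) -> square_at k.
Proof.
  induction k as [|k IH]; intros Tr y u w x Hy Hw Hyx Hxw.
  - assert (R : rise 0 y x).
    { split; [apply (low_S _ _ _ Hy)|]. split; [exact Hyx|].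
      intros r [H _]; congruence. }
    assert (R' : rise 1 (x :: y) w).
    { split; [apply rise_valid, R|]. split; [exact Hxw|].
      intros r Hr.
      destruct (low_pair 0 _ _ _ (Tr 1 (le_n _)) (low_cons _ _ _ R) Hr)
        as [E | (s & [H _] & _)]; [|congruence].
      rewrite <- (eqv_tip _ _ _ E). exact (rise_low _ _ _ _ Hw Hy). }
    split; [exact R | split; [exact R'|]].
    apply eqv_cons; auto. right; exists y; split; [exact Hy | apply low_cons, R].
  - assert (Sq : square_at k) by (apply IH; intros; apply Tr; lia).
    assert (Far : far_at k) by (apply far_of_square; [apply Tr; lia | exact Sq]).
    assert (R : rise (S k) y x).
    { split; [apply (low_S _ _ _ Hy)|]. split; [exact Hyx|].
      intros t Ht. destruct (Far t y u w Ht Hy Hw) as (F1 & F2 & F3).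
      split; [intros <-; auto | intro A; exact (F3 _ A Hxw)]. }
    assert (R' : rise (S (S k)) (x :: y) w).
    { split; [apply rise_valid, R|]. split; [exact Hxw|].
      intros r Hr.
      destruct (low_pair (S k) _ _ _ (Tr _ (le_n _)) (low_cons _ _ _ R) Hr)
        as [E | (s & Hs & Hs')].
      - rewrite <- (eqv_tip _ _ _ E). exact (rise_low _ _ _ _ Hw Hy).
      - destruct (Far s y u w Hs Hy Hw) as (F1 & F2 & F3).
        pose proof (low_adj _ _ _ Hs') as A.
        split; [intros <-; auto | intro A'; exact (F3 _ A A')]. }
    split; [exact R | split; [exact R'|]].
    apply eqv_cons; auto. right; exists y; split; [exact Hy | apply low_cons, R].
Qed.

(** In the main case [u] lies below [p] and [q], and [v] below [q] and [t]. Then [u] and [v] have a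
    common lower neighbour [y], and (LTC) or (LQC) at [tip y], according to whether the tips of [p]
    and [t] are adjacent, gives a vertex below both [p] and [t]. *)
Lemma eqv_trans_step n : (forall m, m <= n -> transitive_at m) -> transitive_at (S n).
Proof.
  intros Tr P Q R H1 H2.
  destruct H1 as (z & p & q & -> & -> & Hp & Hq & H1).
  destruct R as [|z' t]; [destruct H2 as (? & ? & ? & ? & ? & _); discriminate|].
  apply eqv_cons_inv in H2 as (<- & _ & Ht & H2).
  change (rise n p z) in Hp. change (rise n q z) in Hq.
  pose proof (Tr n (le_n _)) as Trn.
  apply eqv_cons; auto.
  destruct H1 as [H1 | (u & Pu & Qu)].
  { destruct H2 as [H2 | (v & Qv & Tv)].
    - left; eapply Trn; eassumption.
    - right; exists v; split; [|exact Tv].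
      eapply low_congr_l; [exact Trn | apply eqv_sym; exact H1 | exact Qv]. }
  destruct H2 as [H2 | (v & Qv & Tv)].
  { right; exists u; split; [exact Pu|].
    eapply low_congr_l; [exact Trn | exact H2 | exact Qu]. }
  change (low n p u) in Pu. change (low n q u) in Qu.
  destruct n as [|n]; [destruct Pu; congruence|].
  pose proof (Tr n (le_S _ _ (le_n _))) as Trn'.
  destruct (low_pair n q u v Trn Qu Qv) as [E | (y & Uy & Vy)].
  { right; exists u; split; [exact Pu|].
    eapply low_congr_r; [exact Trn' | exact Trn | apply eqv_sym; exact E | exact Tv]. }
  destruct n as [|n]; [destruct Uy; congruence|].
  assert (Sq : square_at n) by (apply square_lifts; intros; apply Tr; lia).
  destruct (far_of_square n Trn Sq y u p z Uy Pu Hp) as (F1 & F2 & F3).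
  destruct (rise_low _ _ _ _ (low_S _ _ _ Pu) Uy) as [N1 A1].
  destruct (rise_low _ _ _ _ (low_S _ _ _ Tv) Vy) as [N2 A2].
  (* Over one tip, [p] and [t] prolong [u] and [v] by the same vertex and are identified through
     [y]. *)
  destruct (classic (tip p = tip t)) as [Ept | Npt].
  { left. eapply Trn; [apply eqv_sym, low_eqv; exact Pu|].
    eapply Trn; [|apply low_eqv; exact Tv]. rewrite <- Ept.
    apply eqv_cons.
    - apply low_S; exact Pu.
    - rewrite Ept; apply low_S; exact Tv.
    - right; exists y; split; assumption. }
  assert (X : exists x, adj x (tip y) /\ adj x (tip p) /\ adj x (tip t)).
  { pose proof (low_adj _ _ _ Uy). pose proof (low_adj _ _ _ Pu).
    pose proof (low_adj _ _ _ Vy). pose proof (low_adj _ _ _ Tv).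
    destruct (classic (adj (tip p) (tip t))) as [Apt | Apt].
    - apply (ltc (tip y) (tip p) (tip t) (tip u) (tip v)); assumption.
    - apply (lqc (tip y) (tip p) (tip t) z (tip u) (tip v)); try assumption;
        apply adj_sym; eapply rise_adj; eassumption. }
  destruct X as (x & X1 & X2 & X3).
  right; exists (x :: y); split.
  - apply (square_lower n Trn Sq y u p x); auto.
  - apply (square_lower n Trn Sq y v t x); auto.
Qed.

Lemma eqv_trans n : transitive_at n.
Proof.
  induction n as [n IH] using lt_wf_ind.
  destruct n as [|n].
  - intros p q r [-> _] [_ ->]; split; reflexivity.
  - apply eqv_trans_step; intros; apply IH; lia.
Qed.

(** * Lower neighbours of a class *)

Lemma low_l n p p' r : eqv n p p' -> low n p r -> low n p' r.
Proof. apply low_congr_l, eqv_trans. Qed.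

Lemma low_r m p r r' : eqv m r r' -> low (S m) p r -> low (S m) p r'.
Proof. apply low_congr_r; apply eqv_trans. Qed.

Lemma square k : square_at k.
Proof. apply square_lifts; intros; apply eqv_trans. Qed.

Lemma square_low k t y u x : low (S k) y t -> low (S (S k)) u y ->
  adj (tip t) x -> adj x (tip u) -> low (S (S k)) u (x :: t).
Proof. apply square_lower; [apply eqv_trans | apply square]. Qed.

Lemma far k : far_at k.
Proof. apply far_of_square; [apply eqv_trans | apply square]. Qed.

Lemma low_cases m p r r' : low (S m) p r -> low (S m) p r' ->
  eqv m r r' \/ exists k s, m = S k /\ low (S k) r s /\ low (S k) r' s.
Proof.
  intros H H'. destruct (low_pair m p r r' (eqv_trans _) H H') as [E | (s & Hs & Hs')].
  - left; exact E.
  - right. destruct m as [|k]; [destruct Hs; congruence|]. exists k, s; auto.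
Qed.

Lemma low_unique m p r r' : low (S m) p r -> low (S m) p r' ->
  tip r = tip r' -> eqv m r r'.
Proof.
  intros H H' E. destruct (low_cases _ _ _ _ H H') as [L | (k & s & -> & Hs & Hs')];
    [exact L|].
  eapply eqv_trans; [apply eqv_sym, low_eqv; exact Hs|].
  rewrite E. apply low_eqv; exact Hs'.
Qed.

(** Otherwise a common lower neighbour of [r] and [r'] would lie on their line, which contains
    [tip p], against [rise]. *)
Lemma low_nonadj m p r r' : low (S m) p r -> low (S m) p r' -> ~ adj (tip r) (tip r').
Proof.
  intros H H' A. destruct (low_cases _ _ _ _ H H') as [L | (k & s & -> & Hs & Hs')].
  - apply (adj_irr (tip r')). rewrite (eqv_tip _ _ _ L) in A; exact A.
  - destruct (rise_low _ _ _ _ (low_S _ _ _ H) Hs) as [N1 N2].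
    apply N2. apply (line_unique (tip r) (tip r')); auto.
    + eapply low_adj; exact Hs.
    + eapply low_adj; exact Hs'.
    + apply adj_sym; eapply low_adj; exact H.
    + apply adj_sym; eapply low_adj; exact H'.
Qed.

(** A line that goes up from [r] does so as a whole: a vertex below [r] that equals or is adjacent
    to [z] would be adjacent to [tip p] too. *)
Lemma rise_same k p r z : low (S k) p r -> adj (tip r) z -> adj z (tip p) -> rise k r z.
Proof.
  intros H Hz Hzp. pose proof (low_S _ _ _ H) as R.
  split; [apply R | split; [exact Hz|]].
  intros s Hs. destruct (rise_low _ _ _ _ R Hs) as [N1 N2].
  split.
  - intros <-; auto.
  - intro A. apply N2. apply (line_unique (tip r) z); auto.
    + eapply low_adj; exact Hs.
    + apply adj_sym, (low_adj _ _ _ H).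
Qed.

Lemma low_low_cons k p e t : low (S (S k)) p (e :: t) -> low (S k) (e :: t) t.
Proof.
  intro H. pose proof (proj1 (low_S _ _ _ H)) as V.
  apply eqv_cons_inv in V. apply low_cons, V.
Qed.

Lemma not_rise n p z : eqv n p p -> adj (tip p) z -> ~ rise n p z ->
  exists r, low n p r /\ (tip r = z \/ adj (tip r) z).
Proof.
  intros V A H. apply NNPP; intro N. apply H.
  split; [exact V | split; [exact A|]].
  intros r Hr; split; intro; apply N; exists r; auto.
Qed.

Lemma low_valid n p r : low n p r -> eqv n p p.
Proof. intro H; eapply eqv_refl_r, H. Qed.

(* Adjacency in the covering graph: one level down, one level up, or same level. *)
Definition nb (n : nat) (p : list T) (m : nat) (q : list T) : Prop :=
  (n = S m /\ low (S m) p q) \/ (m = S n /\ low (S n) q p) \/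
  (exists k r, n = S k /\ m = S k /\ low (S k) p r /\ low (S k) q r /\
     adj (tip p) (tip q)).

Lemma nb_down m p q : low (S m) p q -> nb (S m) p m q.
Proof. left; auto. Qed.

Lemma nb_up n p q : low (S n) q p -> nb n p (S n) q.
Proof. right; left; auto. Qed.

Lemma nb_level k p q r : low (S k) p r -> low (S k) q r -> adj (tip p) (tip q) ->
  nb (S k) p (S k) q.
Proof. right; right; exists k, r; auto. Qed.

Lemma nb_sym n p m q : nb n p m q -> nb m q n p.
Proof.
  intros [[-> H] | [[-> H] | (k & r & -> & -> & H1 & H2 & H3)]].
  - apply nb_up, H.
  - apply nb_down, H.
  - eapply nb_level; eauto.
Qed.

Lemma nb_adj n p m q : nb n p m q -> adj (tip p) (tip q).
Proof.
  intros [[-> H] | [[-> H] | (k & r & -> & -> & H1 & H2 & H3)]]; auto.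
  - apply adj_sym, (low_adj _ _ _ H).
  - apply (low_adj _ _ _ H).
Qed.

Lemma nb_valid n p m q : nb n p m q -> eqv m q q.
Proof.
  intros [[-> H] | [[-> H] | (k & r & -> & -> & H1 & H2 & H3)]].
  - apply (low_S _ _ _ H).
  - eapply low_valid; exact H.
  - eapply low_valid; exact H2.
Qed.

Lemma nb_congr_l n p p' m q : eqv n p p' -> nb n p m q -> nb n p' m q.
Proof.
  intros E [[-> H] | [[-> H] | (k & r & -> & -> & H1 & H2 & H3)]].
  - apply nb_down; eapply low_l; eassumption.
  - apply nb_up; eapply low_r; eassumption.
  - apply (nb_level k _ _ r); auto.
    + eapply low_l; eassumption.
    + rewrite <- (eqv_tip _ _ _ E); exact H3.
Qed.

Lemma nb_congr_r n p m q q' : eqv m q q' -> nb n p m q -> nb n p m q'.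
Proof. intros E H; apply nb_sym; eapply nb_congr_l; [exact E | apply nb_sym, H]. Qed.

(** * Stars and triangles lift to the covering graph *)

Lemma star_exists n p z : eqv n p p -> adj (tip p) z ->
  exists m q, nb n p m q /\ tip q = z.
Proof.
  intros V A. destruct (classic (rise n p z)) as [R | R].
  - exists (S n), (z :: p); split; [apply nb_up, low_cons, R | reflexivity].
  - destruct (not_rise _ _ _ V A R) as (r & Hr & [E | A']).
    + destruct n as [|n]; [destruct Hr; congruence|].
      exists n, r; split; [apply nb_down, Hr | exact E].
    + destruct n as [|n]; [destruct Hr; congruence|].
      exists (S n), (z :: r); split; [|reflexivity].
      apply (nb_level n _ _ r); auto.
      apply low_cons, (rise_same _ _ _ _ Hr); auto.
Qed.

(** Neighbours of different kinds have different tips, by [rise] and [low_nonadj]. With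
    [star_exists], [tip] is bijective on neighbourhoods. *)
Lemma star_unique n p m q m' q' : nb n p m q -> nb n p m' q' -> tip q = tip q' ->
  m = m' /\ eqv m q q'.
Proof.
  assert (W : forall m q m' q', nb n p m q -> nb n p m' q' -> tip q = tip q' ->
    m <= m' -> m = m' /\ eqv m q q').
  2:{ intros H H' E. destruct (le_ge_dec m m') as [L | L]; [auto|].
      destruct (W _ _ _ _ H' H (eq_sym E) L) as [-> X].
      split; [reflexivity | apply eqv_sym, X]. }
  clear m q m' q'; intros m q m' q'.
  intros [[-> H] | [[-> H] | (k & r & -> & -> & H1 & H2 & H3)]];
  intros [[E' H'] | [[E' H'] | (k' & r' & E' & E'' & H1' & H2' & H3')]] E L; subst; try lia.
  - injection E' as <-. split; [reflexivity|]. eapply low_unique; eassumption.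
  - exfalso. destruct (rise_low _ _ _ _ (low_S _ _ _ H') H); auto.
  - injection E' as <-. exfalso. apply (low_nonadj _ _ _ _ H H1').
    rewrite E; apply adj_sym; eapply low_adj; exact H2'.
  - split; [reflexivity|]. eapply eqv_trans; [apply eqv_sym, low_eqv; exact H|].
    rewrite E; apply low_eqv; exact H'.
  - exfalso. destruct (rise_low _ _ _ _ (low_S _ _ _ H') H1) as [_ N]; apply N.
    rewrite <- E. eapply low_adj; exact H2.
  - injection E' as <-. split; [reflexivity|].
    assert (Er : eqv k r r').
    { apply (low_unique _ _ _ _ H1 H1'). apply NNPP; intro N.
      apply (low_nonadj _ _ _ _ H1 H1').
      apply (line_unique (tip p) (tip q)); auto.
      - eapply low_adj; exact H1.
      - eapply low_adj; exact H2.
      - eapply low_adj; exact H1'.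
      - rewrite E; eapply low_adj; exact H2'. }
    eapply eqv_trans; [apply eqv_sym, low_eqv; exact H2|].
    eapply eqv_trans; [|apply low_eqv; exact H2'].
    rewrite <- E. apply eqv_cons.
    + apply low_S; exact H2.
    + rewrite E; apply low_S; exact H2'.
    + left; exact Er.
Qed.

(** Either one vertex lies below the other two, or all three have a common lower neighbour; the
    other distributions over the levels contradict [rise] or [low_nonadj]. *)
Lemma triangle_closes n p m q k r : nb n p m q -> nb n p k r ->
  adj (tip q) (tip r) -> nb m q k r.
Proof.
  assert (W : forall m q k r, nb n p m q -> nb n p k r -> adj (tip q) (tip r) ->
    m <= k -> nb m q k r).
  2:{ intros H H' A. destruct (le_ge_dec m k) as [L | L]; [auto|].
      apply nb_sym; auto. }
  clear m q k r; intros m q m' q'.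
  intros [[-> H] | [[-> H] | (k & r & -> & -> & H1 & H2 & H3)]];
  intros [[E' H'] | [[E' H'] | (k' & r' & E' & E'' & H1' & H2' & H3')]] A L; subst; try lia.
  - injection E' as <-. exfalso. exact (low_nonadj _ _ _ _ H H' A).
  - exfalso. destruct (rise_low _ _ _ _ (low_S _ _ _ H') H); auto.
  - injection E' as <-. apply nb_up. apply (low_r _ _ r'); [|exact H2'].
    apply (low_unique _ _ _ _ H1' H). apply NNPP; intro N.
    apply (low_nonadj _ _ _ _ H1' H).
    apply (line_unique (tip p) (tip q')); auto.
    + eapply low_adj; exact H1'.
    + eapply low_adj; exact H2'.
    + eapply low_adj; exact H.
  - apply (nb_level _ _ _ p); auto.
  - exfalso. destruct (rise_low _ _ _ _ (low_S _ _ _ H') H1) as [N1 N2]. apply N2.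
    apply (line_unique (tip p) (tip q)); auto.
    + eapply low_adj; exact H1.
    + eapply low_adj; exact H2.
    + apply adj_sym; eapply low_adj; exact H'.
  - injection E' as <-.
    apply (nb_level _ _ _ r); auto. apply (low_r _ _ r'); [|exact H2'].
    apply (low_unique _ _ _ _ H1' H1). apply NNPP; intro N.
    assert (X : adj (tip r) (tip q')).
    { apply (line_unique (tip p) (tip q)); auto.
      - eapply low_adj; exact H1.
      - eapply low_adj; exact H2.
      - intro X. apply (low_nonadj _ _ _ _ H1' H1). rewrite X.
        eapply low_adj; exact H2'. }
    apply (low_nonadj _ _ _ _ H1' H1).
    apply (line_unique (tip p) (tip q')); auto.
    + eapply low_adj; exact H1'.
    + eapply low_adj; exact H2'.
    + eapply low_adj; exact H1.
Qed.

(** * Induced squares lift to the covering graph *)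

Definition closes (n : nat) (p : list T) (k : nat) (r : list T) (w : T) : Prop :=
  exists l s, nb n p l s /\ nb l s k r /\ tip s = w.

Lemma closes_sym n p k r w : closes n p k r w -> closes k r n p w.
Proof. intros (l & s & H1 & H2 & H3); exists l, s; auto using nb_sym. Qed.

(** Not rising, [w] is [tip c] or adjacent to it for some [c] below [p]. In the adjacent case (LTC)
    at a vertex [t] below [c] and [y], for the edge from [w] to [tip r], puts both ends of that edge
    over one vertex [e]. *)
Lemma closes_common_low_aux k p r y w : low (S k) p y -> low (S k) r y ->
  adj (tip p) w -> adj w (tip r) -> tip p <> tip r -> ~ adj (tip p) (tip r) ->
  ~ rise (S k) p w -> closes (S k) p (S k) r w.
Proof.
  intros Hp Hr Apw Awr N1 N2 NR.
  pose proof (low_adj _ _ _ Hp) as Ayp. pose proof (low_adj _ _ _ Hr) as Ayr.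
  assert (Nyw : ~ adj (tip y) w).
  { intro A. apply N2. apply (line_unique (tip y) w); auto. }
  destruct (not_rise _ _ _ (low_valid _ _ _ Hp) Apw NR) as (c & Hc & HH).
  destruct (low_cases _ _ _ _ Hc Hp) as [E | (j & t & -> & Ct & Yt)].
  { destruct HH as [<- | A].
    - exists k, c; split; [apply nb_down, Hc|]. split; [|reflexivity].
      apply nb_up; eapply low_r; [apply eqv_sym; exact E | exact Hr].
    - exfalso. apply Nyw. rewrite <- (eqv_tip _ _ _ E); exact A. }
  destruct HH as [<- | A].
  { pose proof (low_adj _ _ _ Ct) as Atc.
    exists (S j), (tip c :: t). split; [|split; [|reflexivity]].
    - apply nb_down. apply (square_low _ _ y); auto.
    - apply nb_up. apply (square_low _ _ y); auto. }
  pose proof (rise_same _ _ _ _ Hc A (adj_sym _ _ Apw)) as R.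
  destruct (rise_low _ _ _ _ R Ct) as [M1 M2].
  destruct (rise_low _ _ _ _ (low_S _ _ _ Hr) Yt) as [M3 M4].
  destruct (ltc (tip t) w (tip r) (tip c) (tip y)) as (e & E1 & E2 & E3); auto.
  { eapply low_adj; exact Ct. }
  { eapply low_adj; exact Yt. }
  exists (S (S j)), (w :: c). split; [|split; [|reflexivity]].
  - apply (nb_level _ _ _ c); auto. apply low_cons, R.
  - apply (nb_level _ _ _ (e :: t)); auto.
    + apply (square_low _ _ c); auto. apply low_cons, R.
    + apply (square_low _ _ y); auto.
Qed.

Lemma closes_common_low k p r y w : low (S k) p y -> low (S k) r y ->
  adj (tip p) w -> adj w (tip r) -> tip p <> tip r -> ~ adj (tip p) (tip r) ->
  closes (S k) p (S k) r w.
Proof.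
  intros Hp Hr Apw Awr N1 N2.
  destruct (classic (rise (S k) p w)) as [Rp | Rp];
    [|eapply closes_common_low_aux; eassumption].
  destruct (classic (rise (S k) r w)) as [Rr | Rr];
    [|apply closes_sym; eapply closes_common_low_aux; eauto].
  (* The two prolongations by [w] are identified by definition, as [y] lies below [p] and [r]. *)
  exists (S (S k)), (w :: p). split; [|split; [|reflexivity]].
  - apply nb_up, low_cons, Rp.
  - apply nb_down. apply (low_l _ (w :: r)); [|apply low_cons, Rr].
    apply eqv_cons; auto. right; exists y; auto.
Qed.

Lemma closes_chain k p q r w : low (S k) q p -> low (S (S k)) r q ->
  adj (tip p) w -> adj w (tip r) -> closes k p (S (S k)) r w.
Proof.
  intros Hq Hr Apw Awr.
  destruct (square k p q (tip r) w) as (R & _ & _); auto.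
  { apply low_S, Hr. }
  exists (S k), (w :: p). split; [|split; [|reflexivity]].
  - apply nb_up, low_cons, R.
  - apply nb_up. apply (square_low _ _ q); auto.
Qed.

(** A vertex [t] lies below [c] and [c'], and its distance to [w] in $G$ decides: at distance 1, [w]
    is below [p] and [r]; at distance 2, (LTC) puts it at their level; at distance 3, (LQC) gives
    [p] and [r] a common lower neighbour. *)
Lemma closes_level_level n p q r c c' w :
  low (S n) p c -> low (S n) q c -> adj (tip p) (tip q) ->
  low (S n) q c' -> low (S n) r c' -> adj (tip q) (tip r) ->
  adj (tip p) w -> adj w (tip r) -> tip p <> tip r -> ~ adj (tip p) (tip r) ->
  closes (S n) p (S n) r w.
Proof.
  intros Pc Qc Apq Qc' Rc' Aqr Apw Awr N1 N2.
  destruct (low_cases _ _ _ _ Qc Qc') as [E | (k & t & -> & Ct & Ct')].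
  { exfalso. apply N2. apply (line_unique (tip q) (tip c')); auto.
    - apply adj_sym; eapply low_adj; exact Qc'.
    - apply adj_sym; rewrite <- (eqv_tip _ _ _ E); eapply low_adj; exact Pc.
    - apply adj_sym; eapply low_adj; exact Rc'. }
  destruct (rise_low _ _ _ _ (low_S _ _ _ Pc) Ct) as [M1 M2].
  destruct (rise_low _ _ _ _ (low_S _ _ _ Rc') Ct') as [M3 M4].
  assert (M5 : tip t <> w) by (intros <-; auto).
  pose proof (low_adj _ _ _ Ct) as Atc. pose proof (low_adj _ _ _ Ct') as Atc'.
  pose proof (low_adj _ _ _ Pc) as Acp. pose proof (low_adj _ _ _ Rc') as Acr.
  destruct (classic (adj (tip t) w)) as [Atw | Atw].
  { pose proof (square_low _ _ _ _ w Ct Pc Atw (adj_sym _ _ Apw)) as Lp.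
    pose proof (square_low _ _ _ _ w Ct' Rc' Atw Awr) as Lr.
    exists (S k), (w :: t). split; [|split; [|reflexivity]].
    - apply nb_down, Lp.
    - apply nb_up, Lr. }
  destruct (classic (exists f, adj (tip t) f /\ adj f w)) as [(f & F1 & F2) | F].
  - destruct (ltc (tip t) (tip p) w (tip c) f) as (e & E1 & E2 & E3); auto.
    destruct (ltc (tip t) (tip r) w (tip c') f) as (e' & E1' & E2' & E3'); auto.
    pose proof (square_low _ _ _ _ e Ct Pc (adj_sym _ _ E1) E2) as Lp.
    pose proof (square_low _ _ _ _ e' Ct' Rc' (adj_sym _ _ E1') E2') as Lr.
    pose proof (rise_same _ _ _ w Lp E3 (adj_sym _ _ Apw)) as R.
    pose proof (rise_same _ _ _ w Lr E3' Awr) as R'.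
    exists (S (S k)), (w :: e :: t). split; [|split; [|reflexivity]].
    + apply (nb_level _ _ _ (e :: t)); auto. apply low_cons, R.
    + apply (nb_level _ _ _ (e' :: t)); auto.
      apply (low_l _ (w :: e' :: t)); [|apply low_cons, R'].
      apply eqv_cons; auto. right; exists t.
      split; eapply low_low_cons; eassumption.
  - destruct (lqc (tip t) (tip p) (tip r) w (tip c) (tip c')) as (e & E1 & E2 & E3); auto.
    { intros f F1 F2; apply F; exists f; auto. }
    apply (closes_common_low _ _ _ (e :: t)); auto.
    + apply (square_low _ _ c); auto.
    + apply (square_low _ _ c'); auto.
Qed.

(** If [w] rises over [p], then (LTC) at [tip c] gives a vertex below both [w] and [r]. Otherwise
    [w] is at the level of [p], and (LQC) at a vertex [t] below [c] gives a vertex [g] below both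
    [q] and [w]. *)
Lemma closes_level_up n p q r c w :
  low (S n) p c -> low (S n) q c -> adj (tip p) (tip q) -> low (S (S n)) r q ->
  adj (tip p) w -> adj w (tip r) -> tip q <> w -> ~ adj (tip q) w ->
  closes (S n) p (S (S n)) r w.
Proof.
  intros Pc Qc Apq Rq Apw Awr N1 N2.
  pose proof (low_adj _ _ _ Pc) as Acp. pose proof (low_adj _ _ _ Qc) as Acq.
  pose proof (low_adj _ _ _ Rq) as Aqr.
  destruct (classic (rise (S n) p w)) as [R | R].
  { destruct (rise_low _ _ _ _ R Pc) as [M1 M2].
    destruct (rise_low _ _ _ _ (low_S _ _ _ Rq) Qc) as [M3 M4].
    destruct (ltc (tip c) w (tip r) (tip p) (tip q)) as (v & V1 & V2 & V3); auto.
    exists (S (S n)), (w :: p). split; [|split; [|reflexivity]].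
    - apply nb_up, low_cons, R.
    - apply (nb_level _ _ _ (v :: c)); auto.
      + apply (square_low _ _ p); auto. apply low_cons, R.
      + apply (square_low _ _ q); auto. }
  destruct (not_rise _ _ _ (low_valid _ _ _ Pc) Apw R) as (e & Pe & HH).
  destruct (low_cases _ _ _ _ Pe Pc) as [E | (k & t & -> & Et & Ct)].
  { exfalso. apply eqv_tip in E. destruct HH as [<- | A].
    - apply N2. rewrite E. auto.
    - apply N2. rewrite E in A. apply (line_unique (tip c) (tip p)); auto. }
  destruct (far k t c q (tip r) Ct Qc (low_S _ _ _ Rq)) as (F1 & F2 & F3).
  pose proof (low_adj _ _ _ Et) as Ate. pose proof (low_adj _ _ _ Ct) as Atc.
  destruct HH as [<- | A]; [exfalso; exact (F3 _ Ate Awr)|].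
  destruct (rise_low _ _ _ _ (low_S _ _ _ Qc) Ct) as [M1 M2].
  destruct (lqc (tip t) (tip q) w (tip r) (tip c) (tip e)) as (g & G1 & G2 & G3); auto.
  { intros <-; auto. }
  { intro; eapply F3; eauto. }
  pose proof (rise_same _ _ _ _ Pe A (adj_sym _ _ Apw)) as Rw.
  destruct (square k t e w g Et Rw (adj_sym _ _ G1) G3) as (_ & _ & Eq).
  pose proof (square_low _ _ _ _ g Ct Qc (adj_sym _ _ G1) G2) as Lq.
  exists (S (S k)), (w :: e). split; [|split; [|reflexivity]].
  - apply (nb_level _ _ _ e); auto. apply low_cons, Rw.
  - apply nb_up. apply (low_r _ _ (w :: g :: t)); [apply eqv_sym, Eq|].
    apply (square_low _ _ q); auto.
Qed.

Lemma closes_level_down n p q r c w :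
  low (S n) p c -> low (S n) q c -> low (S n) q r ->
  adj (tip p) w -> adj w (tip r) -> ~ adj (tip p) (tip r) ->
  closes (S n) p n r w.
Proof.
  intros Pc Qc Qr Apw Awr N2.
  pose proof (low_adj _ _ _ Pc) as Acp.
  destruct (low_cases _ _ _ _ Qc Qr) as [E | (k & t & -> & Ct & Rt)].
  { exfalso. apply N2. rewrite <- (eqv_tip _ _ _ E); auto. }
  destruct (rise_low _ _ _ _ (low_S _ _ _ Pc) Ct) as [M1 M2].
  pose proof (low_adj _ _ _ Rt) as Atr. pose proof (low_adj _ _ _ Ct) as Atc.
  assert (M5 : tip t <> w) by (intros <-; auto).
  destruct (classic (adj (tip t) w)) as [Atw | Atw].
  { pose proof (square_low _ _ _ _ w Ct Pc Atw (adj_sym _ _ Apw)) as Lp.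
    exists (S k), (w :: t). split; [|split; [|reflexivity]].
    - apply nb_down, Lp.
    - apply (nb_level _ _ _ t); auto. eapply low_low_cons; exact Lp. }
  destruct (ltc (tip t) (tip p) w (tip c) (tip r)) as (e & E1 & E2 & E3); auto.
  pose proof (square_low _ _ _ _ e Ct Pc (adj_sym _ _ E1) E2) as Lp.
  pose proof (rise_same _ _ _ w Lp E3 (adj_sym _ _ Apw)) as R.
  destruct (square k t (e :: t) w (tip r)) as (_ & R' & Eq); auto.
  { eapply low_low_cons; exact Lp. }
  exists (S (S k)), (w :: e :: t). split; [|split; [|reflexivity]].
  - apply (nb_level _ _ _ (e :: t)); auto. apply low_cons, R.
  - apply nb_down. apply (low_r _ _ (tip r :: t)); [apply low_eqv, Rt|].
    apply (low_l _ (w :: tip r :: t)); [apply eqv_sym, Eq | apply low_cons, R'].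
Qed.

(** Each of the two edges at [q] goes down, goes up or stays level; up to reversal of the path there
    are six cases. The conditions on [w] say that the square is induced. *)
Lemma square_closes n p m q k r w : nb n p m q -> nb m q k r ->
  adj (tip p) w -> adj w (tip r) -> tip p <> tip r -> ~ adj (tip p) (tip r) ->
  tip q <> w -> ~ adj (tip q) w -> closes n p k r w.
Proof.
  intros H H' A1 A2 N1 N2 N3 N4.
  destruct H as [[-> H] | [[-> H] | (j & c & -> & -> & H1 & H2 & H3)]];
  destruct H' as [[E' H'] | [[E' H'] | (j' & c' & E' & E'' & H1' & H2' & H3')]]; subst.
  - apply closes_sym, (closes_chain _ _ q); auto.
  - apply (closes_common_low _ _ _ q); auto.
  - apply closes_sym, (closes_level_up _ _ q _ c'); auto.
  - injection E' as <-. destruct (low_cases _ _ _ _ H H') as [E | (j & t & -> & Pt & Rt)].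
    + exfalso. apply N1, (eqv_tip _ _ _ E).
    + apply (closes_common_low _ _ _ t); auto.
  - apply (closes_chain _ _ q); auto.
  - injection E' as <-. apply closes_sym, (closes_level_down _ _ q _ c'); auto.
  - injection E' as <-. apply (closes_level_down _ _ q _ c); auto.
  - apply (closes_level_up _ _ q _ c); auto.
  - injection E' as <-. apply (closes_level_level _ _ q _ c c'); auto.
Qed.

(** * Lifts of walks and their invariance under homotopy *)

(** Path lifting is a relation because the end of a lift is determined only up to [eqv]. *)
Inductive lift : list T -> nat -> list T -> Prop :=
| lift_base : lift [b] 0 [b]
| lift_step q n p m r : lift q n p -> nb n p m r -> lift (tip r :: q) m r.

Lemma lift_valid q n p : lift q n p -> eqv n p p.
Proof.
  destruct 1 as [|q n p m r _ H].
  - split; reflexivity.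
  - eapply nb_valid; exact H.
Qed.

Lemma lift_hd q n p : lift q n p -> hd b q = tip p.
Proof. destruct 1; reflexivity. Qed.

Lemma lift_nonnil q n p : lift q n p -> q <> [].
Proof. destruct 1; discriminate. Qed.

Lemma lift_congr q n p p' : lift q n p -> eqv n p p' -> lift q n p'.
Proof.
  destruct 1 as [|q n p m r H H']; intro E.
  - destruct E as [_ ->]; constructor.
  - rewrite (eqv_tip _ _ _ E).
    eapply lift_step; [exact H|]. eapply nb_congr_r; eassumption.
Qed.

Lemma lift_cons_inv a l n r : lift (a :: l) n r -> l <> [] ->
  exists m p, lift l m p /\ nb m p n r /\ tip r = a.
Proof. intros H N; inversion H; subst; [congruence|]; eauto. Qed.

Lemma lift_det q n p m r : lift q n p -> lift q m r -> n = m /\ eqv n p r.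
Proof.
  intro H; revert m r; induction H as [|q n p k s H IH Hs]; intros m r H'.
  - inversion H' as [|q n p k s H'' Hs]; subst.
    + repeat split.
    + exfalso; eapply lift_nonnil; [exact H'' | reflexivity].
  - apply lift_cons_inv in H' as (m' & p' & H' & Hn & E);
      [|eapply lift_nonnil; exact H].
    destruct (IH _ _ H') as [<- E'].
    eapply star_unique; [exact Hs | | symmetry; exact E].
    eapply nb_congr_l; [apply eqv_sym; exact E' | exact Hn].
Qed.

(** With [lift_homotopic] and [lift_det] this shows that homotopic valid walks are equivalent. *)
Lemma lift_self n p : eqv n p p -> lift p n p.
Proof.
  revert p; induction n as [|n IH]; intros p H.
  - destruct H as [-> _]; constructor.
  - destruct H as (z & p' & _ & -> & _ & H & _).
    change z with (tip (z :: p')).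
    eapply lift_step; [apply IH, H | apply nb_up, low_cons, H].
Qed.

Lemma lift_exists q : is_walk adj (q ++ [b]) -> exists n p, lift (q ++ [b]) n p.
Proof.
  induction q as [|z q IH]; intro H.
  - exists 0, [b]; constructor.
  - assert (A : adj z (hd b (q ++ [b])) /\ is_walk adj (q ++ [b])).
    { destruct q; inversion H; subst; auto. }
    destruct A as [A W]. destruct (IH W) as (n & p & L).
    rewrite (lift_hd _ _ _ L) in A.
    destruct (star_exists n p z (lift_valid _ _ _ L) (adj_sym _ _ A)) as (m & r & Hr & <-).
    exists m, r. eapply lift_step; eassumption.
Qed.

Lemma lift_app_congr s u v : u <> [] -> v <> [] ->
  (forall n p, lift u n p -> lift v n p) ->
  forall n p, lift (s ++ u) n p -> lift (s ++ v) n p.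
Proof.
  intros Nu Nv H; induction s as [|a s IH]; intros n p L; simpl in *; [auto|].
  apply lift_cons_inv in L as (m & r & L & Hn & <-).
  - eapply lift_step; [apply IH; exact L | exact Hn].
  - destruct s, u; simpl; congruence.
Qed.

Lemma lift_square_half x y z w l n p : induced_C4 adj x y z w ->
  lift (x :: y :: z :: l) n p -> lift (x :: w :: z :: l) n p.
Proof.
  intros (Nxy & Nxz & Nxw & Nyz & Nyw & Nzw & Axy & Ayz & Azw & Awx & Axz & Ayw) L.
  apply lift_cons_inv in L as (m & q & L & Hq & <-); [|discriminate].
  apply lift_cons_inv in L as (k & r & L & Hr & <-); [|discriminate].
  pose proof (lift_hd _ _ _ L) as E; simpl in E; subst z.
  destruct (square_closes _ _ _ _ _ _ w Hr Hq) as (j & s & H1 & H2 & <-); auto.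
  do 2 (eapply lift_step; [|eassumption]). exact L.
Qed.

(** Backtracks are handled by the bijectivity on stars, triangles by [triangle_closes] and squares
    by [square_closes]. *)
Lemma lift_ts_move u v : ts_move adj u v ->
  forall n p, lift u n p <-> lift v n p.
Proof.
  intro H; split; revert n p; destruct H as [s l x y A | s l x y z A1 A2 A3 | s l x y z w C];
    apply lift_app_congr; try discriminate; intros n p L.
  - apply lift_cons_inv in L as (m & q & L & Hq & E); [|discriminate].
    apply lift_cons_inv in L as (k & r & L & Hr & <-); [|discriminate].
    pose proof (lift_hd _ _ _ L) as E'; simpl in E'.
    destruct (star_unique _ _ _ _ _ _ (nb_sym _ _ _ _ Hr) Hq) as [-> X]; [congruence|].
    eapply lift_congr; eassumption.
  - apply lift_cons_inv in L as (m & q & L & Hq & <-); [|discriminate].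
    apply lift_cons_inv in L as (k & r & L & Hr & <-); [|discriminate].
    pose proof (lift_hd _ _ _ L) as E'; simpl in E'; subst z.
    eapply lift_step; [exact L|].
    apply (triangle_closes _ _ _ _ _ _ (nb_sym _ _ _ _ Hr) Hq); auto.
  - eapply lift_square_half; eassumption.
  - pose proof (lift_hd _ _ _ L) as E'; simpl in E'; subst x.
    destruct (star_exists n p y (lift_valid _ _ _ L)) as (m & r & Hr & <-); auto.
    eapply lift_step; [|apply nb_sym; exact Hr].
    eapply lift_step; eassumption.
  - apply lift_cons_inv in L as (m & q & L & Hq & <-); [|discriminate].
    pose proof (lift_hd _ _ _ L) as E'; simpl in E'; subst z.
    destruct (star_exists m q y (lift_valid _ _ _ L)) as (k & r & Hr & <-); auto.
    eapply lift_step; [eapply lift_step; [exact L | exact Hr]|].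
    apply (triangle_closes _ _ _ _ _ _ Hr Hq); auto.
  - apply (lift_square_half x w z y); [|exact L].
    destruct C as (? & ? & ? & ? & ? & ? & ? & ? & ? & ? & ? & ?).
    repeat split; auto.
Qed.

Lemma lift_homotopic u v : ts_homotopic adj u v ->
  forall n p, lift u n p <-> lift v n p.
Proof.
  induction 1; intros n p.
  - apply lift_ts_move; assumption.
  - reflexivity.
  - symmetry; auto.
  - rewrite IHclos_refl_sym_trans1; auto.
Qed.

(** * Equivalent walks are homotopic *)

Lemma ts_homotopic_app s t u v : ts_homotopic adj u v ->
  ts_homotopic adj (s ++ u ++ t) (s ++ v ++ t).
Proof.
  induction 1 as [u v H | | | u v w _ IH1 _ IH2].
  - apply rst_step. destruct H; rewrite <- !app_assoc; simpl;
      rewrite !(app_assoc s pre); econstructor; eassumption.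
  - apply rst_refl.
  - apply rst_sym; assumption.
  - eapply rst_trans; eassumption.
Qed.

Lemma ts_homotopic_cons a u v : ts_homotopic adj u v ->
  ts_homotopic adj (a :: u) (a :: v).
Proof.
  intro H. apply (ts_homotopic_app [a] []) in H. rewrite !app_nil_r in H. exact H.
Qed.

Lemma eqv_decompose n p : eqv n p p -> exists l, p = tip p :: l.
Proof.
  destruct n as [|n].
  - intros [-> _]; exists []; reflexivity.
  - intros (z & p' & _ & -> & _); exists p'; reflexivity.
Qed.

(** Prolongations by [z] of two walks above [r] differ by a square through [z] and [tip r], which is
    induced by [rise] and [line_unique]. *)
Lemma eqv_homotopic n p q : eqv n p q -> ts_homotopic adj p q.
Proof.
  revert p q; induction n as [|n IH]; intros p q.
  - intros [-> ->]; apply rst_refl.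
  - intros (z & p' & q' & -> & -> & Hp & Hq & [H | (r & H1 & H2)]).
    + apply ts_homotopic_cons, IH, H.
    + change (low n p' r) in H1; change (low n q' r) in H2.
      change (rise n p' z) in Hp; change (rise n q' z) in Hq.
      destruct n as [|n]; [destruct H1; congruence|].
      apply (rst_trans _ _ _ (z :: tip p' :: r)).
      { apply ts_homotopic_cons, IH, eqv_sym, low_eqv, H1. }
      apply (rst_trans _ _ _ (z :: tip q' :: r)).
      2:{ apply ts_homotopic_cons, IH, low_eqv, H2. }
      destruct (eqv_decompose n r (proj1 (low_S _ _ _ H1))) as [l El].
      rewrite El.
      destruct (classic (tip p' = tip q')) as [<- | N]; [apply rst_refl|].
      pose proof (low_adj _ _ _ H1). pose proof (low_adj _ _ _ H2).
      pose proof (rise_adj _ _ _ Hp). pose proof (rise_adj _ _ _ Hq).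
      destruct (rise_low _ _ _ _ Hp H1) as [N1 N2].
      apply rst_step. apply (mv_sq [] l).
      repeat split; auto; try (intro X; rewrite X in *; eapply adj_irr; eassumption).
      intro A. apply N2. apply (line_unique (tip p') (tip q')); auto.
Qed.

Lemma nb_homotopic n p m q : nb n p m q -> ts_homotopic adj (tip q :: p) q.
Proof.
  intro H. pose proof (nb_adj _ _ _ _ H) as A.
  destruct H as [[-> H] | [[-> H] | (k & r & -> & -> & H1 & H2 & _)]].
  - apply (rst_trans _ _ _ (tip q :: tip p :: q)).
    { apply ts_homotopic_cons, (eqv_homotopic (S m)), eqv_sym, low_eqv, H. }
    destruct (eqv_decompose m q (proj1 (low_S _ _ _ H))) as [l E].
    rewrite E at 2 3. apply rst_step, (mv_back adj [] l); auto.
  - apply (eqv_homotopic (S n)), low_eqv, H.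
  - apply (rst_trans _ _ _ (tip q :: tip p :: r)).
    { apply ts_homotopic_cons, (eqv_homotopic (S k)), eqv_sym, low_eqv, H1. }
    apply (rst_trans _ _ _ (tip q :: r)).
    2:{ apply (eqv_homotopic (S k)), low_eqv, H2. }
    destruct (eqv_decompose k r (proj1 (low_S _ _ _ H1))) as [l E].
    rewrite E. pose proof (low_adj _ _ _ H1). pose proof (low_adj _ _ _ H2).
    apply rst_step, (mv_tri adj [] l); auto.
Qed.

(** With [lift_exists], every homotopy class of walks from [b] thus contains a valid one. *)
Lemma lift_homotopic_self q n p : lift q n p -> ts_homotopic adj q p.
Proof.
  induction 1 as [|q n p m r _ IH H].
  - apply rst_refl.
  - eapply rst_trans; [apply ts_homotopic_cons, IH | eapply nb_homotopic; exact H].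
Qed.

Lemma eqv_last n p q : eqv n p q -> exists l, p = l ++ [b].
Proof.
  revert p q; induction n as [|n IH]; intros p q.
  - intros [-> _]; exists []; reflexivity.
  - intros (z & p' & _ & -> & _ & H & _).
    destruct (IH _ _ (proj1 H)) as [l ->]; exists (z :: l); reflexivity.
Qed.

Lemma eqv_is_walk n p q : eqv n p q -> is_walk adj p.
Proof.
  revert p q; induction n as [|n IH]; intros p q.
  - intros [-> _]; constructor.
  - intros (z & p' & _ & -> & _ & H & _).
    pose proof (IH _ _ (proj1 H)) as W.
    destruct (eqv_decompose n p' (proj1 H)) as [l E].
    rewrite E in W |- *. constructor; [|exact W]. apply adj_sym, H.
Qed.

End Levels.

(** * Homotopic walks: ends, reversal and cancellation *)

Lemma is_walk_app g s l : is_walk adj (g ++ s :: l) <->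
  is_walk adj (g ++ [s]) /\ is_walk adj (s :: l).
Proof.
  induction g as [|x g IH]; simpl.
  - split; [intro H; split; [constructor | exact H] | tauto].
  - destruct g as [|y g]; simpl in *.
    + split.
      * intro H; inversion H; subst. split; [|assumption].
        constructor; [assumption | constructor].
      * intros [H H']; inversion H; subst; constructor; assumption.
    + split.
      * intro H; inversion H; subst. split; [constructor; tauto | tauto].
      * intros [H H']; inversion H; subst; constructor; tauto.
Qed.

Lemma is_walk_cons_inv x y l : is_walk adj (x :: y :: l) -> adj x y /\ is_walk adj (y :: l).
Proof. intro H; inversion H; auto. Qed.

Lemma is_walk_rev l : is_walk adj l -> is_walk adj (rev l).
Proof.
  induction 1 as [x | x y l A _ IH]; simpl in *; [constructor|].
  rewrite <- app_assoc. apply is_walk_app. split; [exact IH|].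
  constructor; [apply adj_sym, A | constructor].
Qed.

Lemma is_walk_app_congr s x u v : (is_walk adj (x :: u) <-> is_walk adj (x :: v)) ->
  (is_walk adj (s ++ x :: u) <-> is_walk adj (s ++ x :: v)).
Proof. intro H. rewrite (is_walk_app s x u), (is_walk_app s x v); tauto. Qed.

Lemma is_walk_ts_move u v : ts_move adj u v -> (is_walk adj u <-> is_walk adj v).
Proof.
  destruct 1 as [s l x y A | s l x y z A1 A2 A3 | s l x y z w C]; apply is_walk_app_congr.
  - split; intros H.
    + do 2 (apply is_walk_cons_inv in H as [_ H]); exact H.
    + constructor; auto. constructor; auto.
  - split; intros H.
    + do 2 (apply is_walk_cons_inv in H as [_ H]); constructor; auto.
    + apply is_walk_cons_inv in H as [_ H]; constructor; auto; constructor; auto.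
  - destruct C as (? & ? & ? & ? & ? & ? & ? & ? & ? & ? & ? & ?).
    split; intros W; do 2 (apply is_walk_cons_inv in W as [_ W]);
      constructor; auto; constructor; auto.
Qed.

Lemma hd_error_ts_move u v : ts_move adj u v -> hd_error u = hd_error v.
Proof. destruct 1 as [[|] | [|] | [|]]; reflexivity. Qed.

Lemma ts_move_rev u v : ts_move adj u v -> ts_move adj (rev u) (rev v).
Proof.
  destruct 1 as [s l x y A | s l x y z A1 A2 A3 | s l x y z w C];
    rewrite !rev_app_distr; simpl; rewrite <- !app_assoc; simpl.
  - apply mv_back; auto.
  - apply mv_tri; auto.
  - apply mv_sq. destruct C as (? & ? & ? & ? & ? & ? & ? & ? & ? & ? & ? & ?).
    repeat split; auto.
Qed.

Lemma ts_homotopic_rev u v : ts_homotopic adj u v -> ts_homotopic adj (rev u) (rev v).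
Proof.
  induction 1.
  - apply rst_step, ts_move_rev; assumption.
  - apply rst_refl.
  - apply rst_sym; assumption.
  - eapply rst_trans; eassumption.
Qed.

Lemma is_walk_homotopic u v : ts_homotopic adj u v -> (is_walk adj u <-> is_walk adj v).
Proof.
  induction 1; [apply is_walk_ts_move; assumption | tauto | tauto | tauto].
Qed.

Lemma hd_error_homotopic u v : ts_homotopic adj u v -> hd_error u = hd_error v.
Proof.
  induction 1; [apply hd_error_ts_move; assumption | auto | auto | congruence].
Qed.

Lemma end_homotopic g s h t : ts_homotopic adj (g ++ [s]) (h ++ [t]) -> s = t.
Proof.
  intro H. apply ts_homotopic_rev, hd_error_homotopic in H.
  rewrite !rev_app_distr in H; injection H; auto.
Qed.

(** Prepending the second vertex turns the first edge into a backtrack, so the prefix disappears one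
    vertex at a time. *)
Lemma homotopic_cancel g s h k : is_walk adj (g ++ [s]) ->
  ts_homotopic adj (g ++ s :: h) (g ++ s :: k) -> ts_homotopic adj (s :: h) (s :: k).
Proof.
  induction g as [|x g IH]; intros W H; [exact H|].
  assert (E : exists y l, g ++ [s] = y :: l) by (destruct g; simpl; eauto).
  destruct E as (y & l & E).
  assert (F : forall m, g ++ s :: m = y :: l ++ m).
  { intro m. change (s :: m) with ([s] ++ m). rewrite app_assoc, E; reflexivity. }
  simpl in W; rewrite E in W. apply is_walk_cons_inv in W as [A W].
  apply IH; [rewrite E; exact W|].
  simpl in H; rewrite !F in H |- *.
  apply (ts_homotopic_cons y) in H.
  eapply rst_trans; [apply rst_sym, rst_step, (mv_back adj [] (l ++ h)), adj_sym, A|].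
  eapply rst_trans; [exact H|].
  apply rst_step, (mv_back adj [] (l ++ k)), adj_sym, A.
Qed.

Lemma homotopic_backtrack g s b : is_walk adj (g ++ [s]) ->
  hd_error (g ++ [s]) = Some b -> ts_homotopic adj (g ++ s :: rev g) [b].
Proof.
  revert s; induction g as [|x g IH] using rev_ind; intros s W E.
  - injection E as ->; apply rst_refl.
  - rewrite <- app_assoc in W, E; simpl in W, E. apply is_walk_app in W as [W A].
    apply is_walk_cons_inv in A as [A _].
    eapply rst_trans; [|apply (IH x W); destruct g; simpl in *; exact E].
    rewrite rev_app_distr, <- app_assoc; simpl.
    apply rst_step, mv_back, A.
Qed.

(** * The universal cover *)

Section Cover.

Variable b : T.

Notation cover := (cover_vertex adj b).
Notation cadj := (@cover_adj T adj b).
Notation "p \in S" := (proj1_sig S p) (at level 70).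

Lemma mem_walk (S : cover) q : q \in S -> is_walk adj q /\ hd_error q = Some b.
Proof.
  destruct S as [S (p & W & E & H)]; simpl; intro Hq. apply H in Hq.
  split.
  - apply (is_walk_homotopic _ _ Hq), W.
  - rewrite <- (hd_error_homotopic _ _ Hq); exact E.
Qed.

Lemma mem_homotopic (S : cover) p q : p \in S -> q \in S -> ts_homotopic adj p q.
Proof.
  destruct S as [S (r & W & E & H)]; simpl; intros Hp Hq.
  eapply rst_trans; [apply rst_sym, H, Hp | apply H, Hq].
Qed.

Lemma mem_closed (S : cover) p q : p \in S -> ts_homotopic adj p q -> q \in S.
Proof.
  destruct S as [S (r & W & E & H)]; simpl; intros Hp Hq.
  apply H. eapply rst_trans; [apply H, Hp | exact Hq].
Qed.

Lemma cover_ext (S S' : cover) q : q \in S -> q \in S' -> S = S'.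
Proof.
  intros H H'.
  assert (E : proj1_sig S = proj1_sig S').
  { extensionality r. apply propositional_extensionality.
    split; intro Hr.
    - eapply mem_closed; [exact H'|]. exact (mem_homotopic S q r H Hr).
    - eapply mem_closed; [exact H|]. exact (mem_homotopic S' q r H' Hr). }
  destruct S as [S HS], S' as [S' HS']; simpl in *; subst S'.
  f_equal; apply proof_irrelevance.
Qed.

Lemma cover_of_walk p : is_walk adj p -> hd_error p = Some b -> exists S : cover, p \in S.
Proof.
  intros W E.
  exists (exist (fun S => exists p, is_walk adj p /\ hd_error p = Some b /\
            forall q, S q <-> ts_homotopic adj p q)
    (fun q => ts_homotopic adj p q)
    (ex_intro _ p (conj W (conj E (fun q => iff_refl _))))).
  simpl; apply rst_refl.
Qed.

(** The covering projection. Walks in a cover vertex are stored forwards, unlike those of the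
    levels, so the endpoint is the last entry. *)
Definition ends (S : cover) (s : T) : Prop := exists g, (g ++ [s]) \in S.

Lemma ends_exists S : exists s, ends S s.
Proof.
  pose proof (proj2_sig S) as (p & W & _ & H).
  assert (E : exists g s, p = g ++ [s]).
  { destruct p as [|x p] using rev_ind; [inversion W | eauto]. }
  destruct E as (g & s & ->). exists s, g. apply H, rst_refl.
Qed.

Lemma ends_unique S s t : ends S s -> ends S t -> s = t.
Proof.
  intros [g Hg] [h Hh]. eapply end_homotopic, mem_homotopic; eassumption.
Qed.

Lemma cadj_intro (S S' : cover) g s z : (g ++ [s]) \in S -> adj s z ->
  (g ++ [s; z]) \in S' -> cadj S S'.
Proof.
  intros H A H'. exists (g ++ [s]), z. rewrite last_last, <- app_assoc; auto.
Qed.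

(** Adjacency is defined by one representative of [S]; by homotopy invariance any other serves. *)
Lemma cadj_inv (S S' : cover) g s : cadj S S' -> (g ++ [s]) \in S ->
  exists z, adj s z /\ (g ++ [s; z]) \in S'.
Proof.
  intros (p & z & Hp & A & Hz) H.
  pose proof (mem_homotopic _ _ _ Hp H) as E.
  assert (F : exists h t, p = h ++ [t]).
  { pose proof (mem_walk _ _ Hp) as [W _].
    destruct p as [|x p] using rev_ind; [inversion W | eauto]. }
  destruct F as (h & t & ->). rewrite last_last in A.
  pose proof (end_homotopic _ _ _ _ E) as ->.
  exists z; split; [exact A|].
  eapply mem_closed; [exact Hz|].
  apply (ts_homotopic_app [] [z]) in E; simpl in E.
  rewrite <- (app_assoc g) in E. exact E.
Qed.

Lemma cadj_sym (S S' : cover) : cadj S S' -> cadj S' S.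
Proof.
  intro H. destruct (ends_exists S) as (s & g & Hg).
  destruct (cadj_inv _ _ _ _ H Hg) as (z & A & Hz).
  apply (cadj_intro _ _ (g ++ [s]) z s).
  - rewrite <- app_assoc; exact Hz.
  - auto.
  - eapply mem_closed; [exact Hg|]. rewrite <- app_assoc.
    apply rst_sym, rst_step, (mv_back adj g []), A.
Qed.

Lemma cadj_ends (S S' : cover) s t : cadj S S' -> ends S s -> ends S' t -> adj s t.
Proof.
  intros H [g Hg] Ht. destruct (cadj_inv _ _ _ _ H Hg) as (z & A & Hz).
  replace t with z; [exact A|]. eapply ends_unique; [|exact Ht].
  exists (g ++ [s]); rewrite <- app_assoc; exact Hz.
Qed.

Lemma cadj_irr (S : cover) : ~ cadj S S.
Proof.
  intro H. destruct (ends_exists S) as (s & Hs).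
  exact (adj_irr s (cadj_ends _ _ _ _ H Hs Hs)).
Qed.

Lemma cover_star S s z : ends S s -> adj s z -> exists S', cadj S S' /\ ends S' z.
Proof.
  intros [g Hg] A. pose proof (mem_walk _ _ Hg) as [W E].
  destruct (cover_of_walk (g ++ [s; z])) as (S' & HS').
  - apply (is_walk_app g s [z]); split; [exact W|]. constructor; [exact A | constructor].
  - destruct g; exact E.
  - exists S'; split; [eapply cadj_intro; eassumption|].
    exists (g ++ [s]); rewrite <- app_assoc; exact HS'.
Qed.

Lemma cover_local_inj S S' S'' z : cadj S S' -> cadj S S'' -> ends S' z -> ends S'' z ->
  S' = S''.
Proof.
  intros H H' E E'. destruct (ends_exists S) as (s & g & Hg).
  destruct (cadj_inv _ _ _ _ H Hg) as (x & A & Hx).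
  destruct (cadj_inv _ _ _ _ H' Hg) as (y & A' & Hy).
  assert (x = z) as ->.
  { eapply ends_unique; [|exact E]. exists (g ++ [s]); rewrite <- app_assoc; exact Hx. }
  assert (y = z) as ->.
  { eapply ends_unique; [|exact E']. exists (g ++ [s]); rewrite <- app_assoc; exact Hy. }
  eapply cover_ext; eassumption.
Qed.

Lemma cover_triangle S S' S'' x y : cadj S S' -> cadj S S'' -> ends S' x -> ends S'' y ->
  adj x y -> cadj S' S''.
Proof.
  intros H H' E E' Axy. destruct (ends_exists S) as (s & g & Hg).
  destruct (cadj_inv _ _ _ _ H Hg) as (x' & A & Hx).
  destruct (cadj_inv _ _ _ _ H' Hg) as (y' & A' & Hy).
  assert (x' = x) as ->.
  { eapply ends_unique; [|exact E]. exists (g ++ [s]); rewrite <- app_assoc; exact Hx. }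
  assert (y' = y) as ->.
  { eapply ends_unique; [|exact E']. exists (g ++ [s]); rewrite <- app_assoc; exact Hy. }
  apply (cadj_intro _ _ (g ++ [s]) x y); [rewrite <- app_assoc; exact Hx | exact Axy|].
  eapply mem_closed; [exact Hy|]. rewrite <- app_assoc.
  apply rst_sym, rst_step, (mv_tri adj g []); auto.
Qed.

Lemma cover_square S S' S'' s t w : cadj S S' -> cadj S' S'' -> ends S s -> ends S'' t ->
  s <> t -> ~ adj s t -> adj s w -> adj w t ->
  exists W, cadj S W /\ cadj W S'' /\ ends W w.
Proof.
  intros H H' Es Et N NA Asw Awt. destruct Es as [g Hg].
  destruct (cadj_inv _ _ _ _ H Hg) as (x & A & Hx).
  assert (Hx' : ((g ++ [s]) ++ [x]) \in S') by (rewrite <- app_assoc; exact Hx).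
  destruct (cadj_inv _ _ _ _ H' Hx') as (t' & A' & Ht).
  assert (t' = t) as ->.
  { eapply ends_unique; [|exact Et]. exists (g ++ [s; x]).
    rewrite <- !app_assoc in *; exact Ht. }
  destruct (classic (w = x)) as [-> | Nwx].
  { exists S'; split; [exact H | split; [exact H'|]]. exists (g ++ [s]); exact Hx'. }
  destruct (cover_star S s w) as (W & HW & EW); [exists g; exact Hg | exact Asw|].
  exists W; split; [exact HW | split; [|exact EW]].
  destruct (cadj_inv _ _ _ _ HW Hg) as (w' & _ & Hw).
  assert (w' = w) as ->.
  { eapply ends_unique; [|exact EW]. exists (g ++ [s]); rewrite <- app_assoc; exact Hw. }
  apply (cadj_intro _ _ (g ++ [s]) w t); [rewrite <- app_assoc; exact Hw | exact Awt|].
  eapply mem_closed; [exact Ht|]. rewrite <- !app_assoc; simpl.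
  apply rst_step, (mv_sq g []).
  repeat split; auto; try (intros ->; eapply adj_irr; eassumption).
  intro Axw. apply NA. apply (line_unique x w); auto.
Qed.

(* Vertices [S'] of the cover are measured from an arbitrary vertex [S] with
   endpoint [s]: [h] is a walk of level [n], constructed with base point [s], that
   leads from [S] to [S']. *)
Definition level (s : T) (S S' : cover) (n : nat) (h : list T) : Prop :=
  eqv s n h h /\ exists g, (g ++ [s]) \in S /\ (g ++ rev h) \in S'.

Lemma eqv_rev s n h k : eqv s n h k -> exists l, rev h = s :: l.
Proof.
  intro H. destruct (eqv_last s n h k H) as [l ->].
  rewrite rev_app_distr; simpl; eauto.
Qed.

Lemma level_any s S S' n h g : level s S S' n h -> (g ++ [s]) \in S -> (g ++ rev h) \in S'.
Proof.
  intros (V & g' & H1 & H2) H. eapply mem_closed; [exact H2|].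
  destruct (eqv_rev _ _ _ _ V) as [l E]. rewrite E.
  pose proof (mem_homotopic _ _ _ H1 H) as X.
  apply (ts_homotopic_app [] l) in X; simpl in X; rewrite <- !app_assoc in X; exact X.
Qed.

(** From [s] one walks back to [b] along [g] and on to [S'] along [p]; the end of the lift of this
    walk is [h]. *)
Lemma level_exists s S S' : ends S s -> exists n h, level s S S' n h.
Proof.
  intros [g Hg]. pose proof (mem_walk _ _ Hg) as [W E].
  destruct (proj2_sig S') as (p & W' & E' & Hp).
  pose proof (proj2 (Hp p) (rst_refl _ _ p)) as Mp.
  destruct p as [|b' p]; [discriminate|]. injection E' as ->.
  assert (F : exists f, g ++ [s] = b :: f).
  { destruct g as [|x g]; injection E as <-; simpl; eauto. }
  destruct F as [f F].
  assert (Wc : is_walk adj ((rev p ++ g) ++ [s])).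
  { rewrite <- app_assoc, F. apply is_walk_app; split.
    - change (is_walk adj (rev (b :: p))). apply is_walk_rev, W'.
    - rewrite <- F; exact W. }
  destruct (lift_exists s (rev p ++ g) Wc) as (n & h & L).
  pose proof (lift_valid _ _ _ _ L) as V.
  exists n, h; split; [exact V|]. exists g; split; [exact Hg|].
  eapply mem_closed; [exact Mp|].
  pose proof (ts_homotopic_app [] p _ _ (homotopic_backtrack g s b W E)) as Y.
  simpl in Y. rewrite <- app_assoc in Y.
  eapply rst_trans; [apply rst_sym, Y|].
  pose proof (ts_homotopic_rev _ _ (lift_homotopic_self s _ _ _ L)) as X.
  rewrite !rev_app_distr, rev_involutive in X; simpl in X.
  apply (ts_homotopic_app g []) in X. rewrite !app_nil_r in X. exact X.
Qed.

(** Cancelling the walk to [S] leaves two homotopic walks from [s], and these have the same lift. *)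
Lemma level_unique s S S' n h m k : level s S S' n h -> level s S S' m k ->
  n = m /\ eqv s n h k.
Proof.
  intros H H'. destruct H as (V & g & H1 & H2). pose proof (level_any _ _ _ _ _ _ H' H1) as H3.
  destruct H' as (V' & _).
  destruct (eqv_rev _ _ _ _ V) as [l El]. destruct (eqv_rev _ _ _ _ V') as [l' El'].
  pose proof (mem_homotopic _ _ _ H2 H3) as X. rewrite El, El' in X.
  apply homotopic_cancel in X; [|apply (mem_walk _ _ H1)].
  rewrite <- El, <- El' in X. apply ts_homotopic_rev in X. rewrite !rev_involutive in X.
  apply lift_self in V. apply lift_self in V'.
  rewrite (lift_homotopic s _ _ X) in V. eapply lift_det; eassumption.
Qed.

Lemma level_functional s S S' S'' n h k : level s S S' n h -> level s S S'' n k ->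
  eqv s n h k -> S' = S''.
Proof.
  intros (V & g & H1 & H2) H' E. pose proof (level_any _ _ _ _ _ _ H' H1) as H3.
  apply (cover_ext _ _ (g ++ rev k)); [|exact H3].
  eapply mem_closed; [exact H2|].
  apply eqv_homotopic, ts_homotopic_rev in E; auto.
  apply (ts_homotopic_app g []) in E. rewrite !app_nil_r in E. exact E.
Qed.

Lemma level_nb_cadj s S S' S'' n h m k : level s S S' n h -> level s S S'' m k ->
  nb s n h m k -> cadj S' S''.
Proof.
  intros (V & g & H1 & H2) H' N. pose proof (level_any _ _ _ _ _ _ H' H1) as H3.
  destruct (eqv_decompose _ _ _ V) as [l E].
  assert (Er : rev h = rev l ++ [hd s h]) by (rewrite E; reflexivity).
  rewrite Er, app_assoc in H2.
  apply (cadj_intro _ _ (g ++ rev l) (hd s h) (hd s k)); [exact H2 | |].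
  - eapply nb_adj; exact N.
  - eapply mem_closed; [exact H3|].
    pose proof (ts_homotopic_rev _ _ (nb_homotopic _ _ _ _ _ N)) as X.
    simpl in X. rewrite Er, <- app_assoc in X; simpl in X.
    apply (ts_homotopic_app g []) in X. rewrite !app_nil_r, app_assoc in X.
    apply rst_sym; exact X.
Qed.

Lemma level_cadj_nb s S S' S'' n h m k : level s S S' n h -> level s S S'' m k ->
  cadj S' S'' -> nb s n h m k.
Proof.
  intros H H' A. pose proof H as (V & g & H1 & H2).
  destruct (eqv_decompose _ _ _ V) as [l E].
  assert (Er : rev h = rev l ++ [hd s h]) by (rewrite E; reflexivity).
  pose proof H2 as H2'. rewrite Er, app_assoc in H2'.
  destruct (cadj_inv _ _ _ _ A H2') as (z & Az & Hz).
  destruct (star_exists s n h z V Az) as (m' & k' & N & Ek).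
  pose proof (nb_valid _ _ _ _ _ N) as V'.
  assert (L : level s S S'' m' k').
  { split; [exact V'|]. exists g; split; [exact H1|].
    eapply mem_closed; [exact Hz|].
    pose proof (ts_homotopic_rev _ _ (nb_homotopic _ _ _ _ _ N)) as X.
    simpl in X. rewrite Er, <- app_assoc, Ek in X; simpl in X.
    apply (ts_homotopic_app g []) in X. rewrite !app_nil_r, app_assoc in X. exact X. }
  destruct (level_unique _ _ _ _ _ _ _ L H') as [-> X].
  eapply nb_congr_r; eassumption.
Qed.

Lemma level_self s S : ends S s -> level s S S 0 [s].
Proof. intros [g Hg]. split; [split; reflexivity|]. exists g; auto. Qed.

Lemma level_realize s P n k : ends P s -> eqv s n k k -> exists Q, level s P Q n k.
Proof.
  intros [g Hg] V. destruct (mem_walk _ _ Hg) as [W E].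
  pose proof (is_walk_rev _ (eqv_is_walk _ _ _ _ V)) as W'.
  destruct (eqv_rev _ _ _ _ V) as [l El].
  destruct (cover_of_walk (g ++ rev k)) as (Q & HQ).
  - rewrite El in W' |- *. apply is_walk_app; auto.
  - rewrite El. destruct g; exact E.
  - exists Q; split; [exact V | exists g; auto].
Qed.

Lemma level_ends s P Q n h : level s P Q n h -> ends P s.
Proof. intros (_ & g & Hg & _); exists g; exact Hg. Qed.

Lemma level_low s P Q n h k : level s P Q (S n) h -> low s (S n) h k ->
  exists R, level s P R n k /\ cadj R Q.
Proof.
  intros L H. destruct (level_realize s P n k) as (R & LR).
  - eapply level_ends; exact L.
  - apply (low_S _ _ _ _ H).
  - exists R; split; [exact LR|]. eapply level_nb_cadj; [exact LR | exact L | apply nb_up, H].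
Qed.

Lemma eqv_low s n h : eqv s (S n) h h -> exists k, low s (S n) h k.
Proof. intros (z & p & _ & -> & _ & R & _). exists p. apply low_cons, R. Qed.

(** Descending through lower neighbours gives a path of length [n]; conversely, an edge changes the
    level by at most 1. *)
Lemma level_dist s P Q n h : level s P Q n h -> dist_is cadj P Q n.
Proof.
  intro H. split.
  - revert Q h H; induction n as [|n IH]; intros Q h H.
    + replace Q with P; [constructor|].
      eapply level_functional; [apply level_self; eapply level_ends; exact H | exact H|].
      destruct H as [[-> _] _]; split; reflexivity.
    + destruct (eqv_low _ _ _ (proj1 H)) as [k Hk].
      destruct (level_low _ _ _ _ _ _ H Hk) as (R & L & A).
      eapply walkn_snoc; [eapply IH; exact L | exact A].
  - intros m W.
    enough (G : forall P1 P2 j, walkn cadj P1 P2 j -> forall n1 h1 n2 h2,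
      level s P P1 n1 h1 -> level s P P2 n2 h2 -> n2 <= n1 + j).
    { exact (G _ _ _ W _ _ _ _ (level_self _ _ (level_ends _ _ _ _ _ H)) H). }
    induction 1 as [P1 | P1 P2 P3 j A _ IH]; intros n1 h1 n3 h3 L1 L3.
    + destruct (level_unique _ _ _ _ _ _ _ L1 L3) as [-> _]; lia.
    + destruct (level_exists s P P2 (level_ends _ _ _ _ _ L1)) as (n2 & h2 & L2).
      specialize (IH _ _ _ _ L2 L3).
      pose proof (level_cadj_nb _ _ _ _ _ _ _ _ L1 L2 A) as N.
      destruct N as [[-> _] | [[-> _] | (? & ? & -> & -> & _)]]; lia.
Qed.

Lemma dist_level s P Q n : ends P s -> dist_is cadj P Q n -> exists h, level s P Q n h.
Proof.
  intros E D. destruct (level_exists s P Q E) as (m & h & L).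
  rewrite (dist_is_unique _ _ _ _ _ _ D (level_dist _ _ _ _ _ L)). eauto.
Qed.

Lemma cover_is_graph : is_graph cadj.
Proof.
  split; [exact cadj_sym | split; [exact cadj_irr|]].
  intros P Q. destruct (ends_exists P) as [s E].
  destruct (level_exists s P Q E) as (n & h & L).
  exists n. apply (level_dist _ _ _ _ _ L).
Qed.

(** * Local and metric conditions in the cover *)

(** With levels measured from [P], neighbours at the same level have a common lower neighbour by the
    definition of [nb]. *)
Lemma cover_triangle_condition P Q R k : cadj Q R ->
  dist_is cadj P Q (S k) -> dist_is cadj P R (S k) ->
  exists X, cadj X Q /\ cadj X R /\ dist_is cadj P X k.
Proof.
  intros A DQ DR. destruct (ends_exists P) as [s E].
  destruct (dist_level _ _ _ _ E DQ) as [q LQ].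
  destruct (dist_level _ _ _ _ E DR) as [r LR].
  pose proof (level_cadj_nb _ _ _ _ _ _ _ _ LQ LR A) as N.
  destruct N as [[N _] | [[N _] | (j & x & [= <-] & _ & Hq & Hr & _)]]; try lia.
  destruct (level_low _ _ _ _ _ _ LQ Hq) as (X & LX & AX).
  exists X; split; [exact AX | split; [|eapply level_dist; exact LX]].
  eapply level_nb_cadj; [exact LX | exact LR | apply nb_up, Hr].
Qed.

Lemma cover_quadrangle_condition P Q R Z k : cadj Z Q -> cadj Z R -> Q <> R ->
  dist_is cadj P Q (S k) -> dist_is cadj P R (S k) -> dist_is cadj P Z (S (S k)) ->
  exists X, cadj X Q /\ cadj X R /\ dist_is cadj P X k.
Proof.
  intros AQ AR N DQ DR DZ. destruct (ends_exists P) as [s E].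
  destruct (dist_level _ _ _ _ E DQ) as [q LQ].
  destruct (dist_level _ _ _ _ E DR) as [r LR].
  destruct (dist_level _ _ _ _ E DZ) as [z LZ].
  pose proof (level_cadj_nb _ _ _ _ _ _ _ _ LZ LQ AQ) as NQ.
  pose proof (level_cadj_nb _ _ _ _ _ _ _ _ LZ LR AR) as NR.
  destruct NQ as [[_ NQ] | [[NQ _] | (j & x & [= <-] & NQ & _)]]; try lia.
  destruct NR as [[_ NR] | [[NR _] | (j & x & [= <-] & NR & _)]]; try lia.
  destruct (low_cases _ _ _ _ _ NQ NR) as [X | (j & x & [= <-] & Hq & Hr)].
  { exfalso; apply N. eapply level_functional; eassumption. }
  destruct (level_low _ _ _ _ _ _ LQ Hq) as (X & LX & AX).
  exists X; split; [exact AX | split; [|eapply level_dist; exact LX]].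
  eapply level_nb_cadj; [exact LX | exact LR | apply nb_up, Hr].
Qed.

Lemma cover_line_unique P Q A C : cadj P Q -> cadj A P -> cadj A Q ->
  cadj C P -> cadj C Q -> A <> C -> cadj A C.
Proof.
  intros PQ AP AQ CP CQ N.
  destruct (ends_exists P) as [p Ep]. destruct (ends_exists Q) as [q Eq].
  destruct (ends_exists A) as [a Ea]. destruct (ends_exists C) as [c Ec].
  apply (cover_triangle P _ _ a c); auto using cadj_sym.
  apply (line_unique p q); eauto using cadj_ends.
  intros <-. apply N. apply (cover_local_inj P _ _ a); auto using cadj_sym.
Qed.

(** Seen from the common neighbour [R], equal or adjacent endpoints would lift to equal or adjacent
    vertices. *)
Lemma cover_dist_2 P Q p q : ends P p -> ends Q q -> dist_is cadj P Q 2 ->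
  dist_is adj p q 2.
Proof.
  intros Ep Eq D. apply dist_is_2 in D as (N & NA & R & A1 & A2).
  destruct (ends_exists R) as [r Er].
  apply dist_is_2. split; [|split].
  - intros <-. apply N. apply (cover_local_inj R _ _ p); auto using cadj_sym.
  - intro A. apply NA. apply (cover_triangle R _ _ p q); auto using cadj_sym.
  - exists r; split; [exact (cadj_ends _ _ _ _ A1 Ep Er) | exact (cadj_ends _ _ _ _ A2 Er Eq)].
Qed.

(** If [p] and [q] had a common neighbour, (LTC) at [p] would give a neighbour [w] of [p], [y] and
    [q], and its lift would be adjacent to both [P] and [Q]. *)
Lemma cover_dist_3 P Q p q : ends P p -> ends Q q -> dist_is cadj P Q 3 ->
  dist_is adj p q 3.
Proof.
  intros Ep Eq D. apply dist_is_3 in D as (N & NA & NC & X & Y & A1 & A2 & A3).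
  destruct (ends_exists X) as [x Ex]. destruct (ends_exists Y) as [y Ey].
  assert (D2 : dist_is adj p y 2).
  { apply (cover_dist_2 P Y); auto. apply dist_is_2.
    split; [intros ->; auto | split; [|eauto]]. intro A; eauto. }
  apply dist_is_2 in D2 as (Npy & NApy & _).
  pose proof (cadj_ends _ _ _ _ A1 Ep Ex) as Apx.
  pose proof (cadj_ends _ _ _ _ A2 Ex Ey) as Axy.
  pose proof (cadj_ends _ _ _ _ A3 Ey Eq) as Ayq.
  assert (Npq : p <> q) by (intros <-; auto).
  assert (NApq : ~ adj p q).
  { intro A. destruct (cover_square P X Y p y q) as (W & W1 & W2 & W3); auto.
    apply NA. replace Q with W; [exact W1|].
    apply (cover_local_inj Y _ _ q); auto using cadj_sym. }
  apply dist_is_3; split; [exact Npq | split; [exact NApq | split]].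
  - intros e E1 E2.
    destruct (ltc p y q x e) as (w & W1 & W2 & W3); auto.
    destruct (cover_square P X Y p y w) as (W & HW1 & HW2 & HW3); auto.
    apply (NC W HW1). apply (cover_triangle Y _ _ w q); auto using cadj_sym.
  - eauto.
Qed.

Lemma cover_thick :
  (forall u v c, dist_is adj u v 2 -> adj u c -> adj c v ->
     exists d, d <> c /\ adj u d /\ adj d v) ->
  forall P Q R, dist_is cadj P Q 2 -> cadj P R -> cadj R Q ->
    exists W, W <> R /\ cadj P W /\ cadj W Q.
Proof.
  intros H P Q R D A1 A2.
  destruct (ends_exists P) as [p Ep]. destruct (ends_exists Q) as [q Eq].
  destruct (ends_exists R) as [r Er].
  pose proof (cover_dist_2 _ _ _ _ Ep Eq D) as D'.
  destruct (H p q r D') as (w & Nw & B1 & B2); eauto using cadj_ends.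
  apply dist_is_2 in D' as (N & NA & _).
  destruct (cover_square P R Q p q w) as (W & W1 & W2 & W3); auto.
  exists W; split; [|auto]. intros ->. apply Nw. eapply ends_unique; eassumption.
Qed.

Lemma cover_no_isometric_K33minus : no_isometric_K33minus adj -> no_isometric_K33minus cadj.
Proof.
  intros H (A1 & A2 & A3 & B1 & B2 & B3 & D). apply H.
  destruct (ends_exists A1) as [a1 ?]. destruct (ends_exists A2) as [a2 ?].
  destruct (ends_exists A3) as [a3 ?]. destruct (ends_exists B1) as [b1 ?].
  destruct (ends_exists B2) as [b2 ?]. destruct (ends_exists B3) as [b3 ?].
  exists a1, a2, a3, b1, b2, b3.
  assert (D1 : forall P Q p q, ends P p -> ends Q q -> dist_is cadj P Q 1 ->
    dist_is adj p q 1).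
  { intros P Q p q Ep Eq X. apply dist_is_1; [exact adj_irr|].
    apply dist_is_1 in X; [|exact cadj_irr]. eapply cadj_ends; eassumption. }
  repeat match goal with X : _ /\ _ |- _ => destruct X end.
  repeat split; first [eapply D1; eassumption | eapply cover_dist_2; eassumption
    | eapply cover_dist_3; eassumption].
Qed.

Lemma cover_locally_finite : locally_finite adj -> locally_finite cadj.
Proof.
  intros F P. destruct (ends_exists P) as [p Ep]. destruct (F p) as [l Hl].
  enough (G : forall l : list T, exists L, forall Q q, cadj P Q -> ends Q q -> In q l -> In Q L).
  { destruct (G l) as [L HL]. exists L; intros Q A.
    destruct (ends_exists Q) as [q Eq]. eapply HL; eauto.
    apply Hl. exact (cadj_ends _ _ _ _ A Ep Eq). }
  clear l Hl; induction l as [|x l [L IH]].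
  - exists []. intros Q q _ _ [].
  - destruct (classic (exists X, cadj P X /\ ends X x)) as [(X & A & E) | N].
    + exists (X :: L). intros Q q AQ Eq [<- | Hq]; [|right; eauto].
      left. eapply cover_local_inj; eassumption.
    + exists L. intros Q q AQ Eq [<- | Hq]; [|eauto]. exfalso; eauto.
Qed.

End Cover.

End LocallyWeaklyModular.
(** * Quads *)

Section DualPolar.

Variable T : Type.
Variable adj : T -> T -> Prop.
Hypothesis adj_sym : forall x y, adj x y -> adj y x.
Hypothesis adj_irr : forall x, ~ adj x x.
Hypothesis connected : forall u v, exists n, walkn adj u v n.

(** * The distance as a function *)

Lemma dist_exists u v : exists n, dist_is adj u v n.
Proof.
  destruct (connected u v) as [n W]. revert W.
  induction n as [n IH] using lt_wf_ind; intro W.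
  destruct (classic (exists m, m < n /\ walkn adj u v m)) as [(m & Hm & W') | N].
  - exact (IH m Hm W').
  - exists n; split; [exact W|]. intros m W'.
    destruct (le_lt_dec n m) as [H | H]; [exact H | exfalso; eauto].
Qed.

Definition d (u v : T) : nat :=
  proj1_sig (constructive_indefinite_description _ (dist_exists u v)).

Lemma d_spec u v : dist_is adj u v (d u v).
Proof. unfold d; apply proj2_sig. Qed.

Lemma d_eq u v n : dist_is adj u v n <-> d u v = n.
Proof.
  split.
  - apply dist_is_unique, d_spec.
  - intros <-; apply d_spec.
Qed.

Lemma d_min u v n : walkn adj u v n -> d u v <= n.
Proof. apply d_spec. Qed.

Lemma d_0 u v : d u v = 0 <-> u = v.
Proof. rewrite <- d_eq; apply dist_is_0. Qed.

Lemma d_refl u : d u u = 0.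
Proof. apply d_0; reflexivity. Qed.

Lemma d_1 u v : d u v = 1 <-> adj u v.
Proof. rewrite <- d_eq; apply dist_is_1, adj_irr. Qed.

Lemma d_2 u v c : u <> v -> ~ adj u v -> adj u c -> adj c v -> d u v = 2.
Proof. intros; apply d_eq, dist_is_2; eauto. Qed.

Lemma d_2_inv u v : d u v = 2 -> u <> v /\ ~ adj u v /\ exists c, adj u c /\ adj c v.
Proof. rewrite <- d_eq, dist_is_2; tauto. Qed.

Lemma walkn_rev u v n : walkn adj u v n -> walkn adj v u n.
Proof.
  induction 1 as [x | x y z n A _ IH]; [constructor|].
  eapply walkn_snoc; eauto.
Qed.

Lemma d_sym u v : d u v = d v u.
Proof.
  apply Nat.le_antisymm; apply d_min, walkn_rev, d_spec.
Qed.

Lemma walkn_app u v w n m : walkn adj u v n -> walkn adj v w m -> walkn adj u w (n + m).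
Proof.
  induction 1 as [x | x y z n A _ IH]; intro W; [exact W|].
  econstructor; [exact A | auto].
Qed.

Lemma d_tri u v w : d u w <= d u v + d v w.
Proof. apply d_min. eapply walkn_app; apply d_spec. Qed.

Lemma d_adj u v w : adj v w -> d u w <= S (d u v).
Proof. intro A. apply d_1 in A. pose proof (d_tri u v w); lia. Qed.

Lemma d_step u v n : d u v = S n -> exists w, adj u w /\ d w v = n.
Proof.
  intro E. pose proof (d_spec u v) as [W _]. rewrite E in W.
  inversion W as [|? w ? ? A W']; subst. exists w; split; [exact A|].
  apply d_min in W'. pose proof (d_tri u w v). apply d_1 in A. lia.
Qed.

Lemma interval_d u v x : in_interval adj u v x <-> d u x + d x v = d u v.
Proof.
  split.
  - intros (a & c & H1 & H2 & H3). apply d_eq in H1, H2, H3. lia.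
  - intro H. exists (d u x), (d x v). rewrite H. auto using d_spec.
Qed.

Hypothesis line_unique : forall x y a c,
  adj x y -> adj a x -> adj a y -> adj c x -> adj c y -> a <> c -> adj a c.
Hypothesis triangle_condition : forall u v w k, adj v w ->
  dist_is adj u v (S k) -> dist_is adj u w (S k) ->
  exists x, adj x v /\ adj x w /\ dist_is adj u x k.
Hypothesis quadrangle_condition : forall u v w z k, adj z v -> adj z w -> v <> w ->
  dist_is adj u v (S k) -> dist_is adj u w (S k) -> dist_is adj u z (S (S k)) ->
  exists x, adj x v /\ adj x w /\ dist_is adj u x k.
Hypothesis second_midpoint : forall u v c, dist_is adj u v 2 -> adj u c -> adj c v ->
  exists e, e <> c /\ adj u e /\ adj e v.
Hypothesis no_K33minus : no_isometric_K33minus adj.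

Lemma tc u v w k : adj v w -> d u v = S k -> d u w = S k ->
  exists x, adj x v /\ adj x w /\ d u x = k.
Proof.
  intros A H1 H2. apply d_eq in H1, H2.
  destruct (triangle_condition u v w k A H1 H2) as (x & X1 & X2 & X3).
  apply d_eq in X3; eauto.
Qed.

Lemma qc u v w z k : adj z v -> adj z w -> v <> w ->
  d u v = S k -> d u w = S k -> d u z = S (S k) ->
  exists x, adj x v /\ adj x w /\ d u x = k.
Proof.
  intros A1 A2 N H1 H2 H3. apply d_eq in H1, H2, H3.
  destruct (quadrangle_condition u v w z k A1 A2 N H1 H2 H3) as (x & X1 & X2 & X3).
  apply d_eq in X3; eauto.
Qed.

(** * Gates of maximal cliques *)

Lemma min_dist (S : T -> Prop) x y : S y ->
  exists g, S g /\ forall z, S z -> d x g <= d x z.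
Proof.
  remember (d x y) as n eqn:E; revert y E.
  induction n as [n IH] using lt_wf_ind; intros y E Hy.
  destruct (classic (exists z, S z /\ d x z < n)) as [(z & Hz & L) | N].
  - eapply IH; [exact L | reflexivity | exact Hz].
  - exists y; split; [exact Hy|]. intros z Hz. rewrite <- E.
    destruct (le_lt_dec n (d x z)) as [L | L]; [exact L | exfalso; eauto].
Qed.

Lemma gated_intro (S : T -> Prop) x g : S g ->
  (forall y, S y -> d x y = d x g + d g y) ->
  exists x', S x' /\ forall y, S y -> in_interval adj x y x'.
Proof.
  intros Sg H. exists g; split; [exact Sg|]. intros y Hy. apply interval_d; symmetry; auto.
Qed.

Lemma gated_gate (S : T -> Prop) x : gated adj S ->
  exists g, S g /\ forall y, S y -> d x y = d x g + d g y.
Proof.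
  intro H. destruct (H x) as (g & Sg & Hg). exists g; split; [exact Sg|].
  intros y Hy. symmetry; apply interval_d; auto.
Qed.

(** A nearest vertex [g] is the gate: for a second vertex of [K] at the same distance, the triangle
    condition gives a vertex nearer to [x], which lies in [K] by [line_unique] and maximality. *)
Lemma maximal_cliques_gated : A1 adj.
Proof.
  intros K [KC KM] x.
  (* The empty clique is not maximal, since the singleton of [x] extends it. *)
  assert (E : exists y, K y).
  { apply NNPP; intro N. apply N. exists x.
    apply (KM (fun z => z = x)); [intros ? ? -> ->; congruence | | reflexivity].
    intros z Kz; exfalso; eauto. }
  destruct E as [y Ky].
  destruct (min_dist K x y Ky) as (g & Kg & Min).
  apply (gated_intro _ _ g); [exact Kg|]. intros z Kz.
  destruct (classic (g = z)) as [<- | N]; [rewrite d_refl; lia|].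
  pose proof (KC g z Kg Kz N) as A. pose proof (proj2 (d_1 g z) A) as A1.
  pose proof (d_adj x g z A). pose proof (Min z Kz).
  destruct (Nat.eq_dec (d x z) (d x g)) as [E | E]; [exfalso | lia].
  destruct (d x g) as [|k] eqn:Eg.
  { apply d_0 in Eg, E; congruence. }
  destruct (tc x g z k A Eg E) as (r & R1 & R2 & R3).
  assert (Kr : K r).
  { apply (KM (fun z => K z \/ z = r)); [|auto|auto].
    assert (W : forall a, K a -> a <> r -> adj a r).
    { intros a Ka Na. destruct (classic (a = g)) as [-> | Nag]; [auto|].
      destruct (classic (a = z)) as [-> | Naz]; [auto|].
      apply (line_unique g z); auto. }
    intros a c [Ka | ->] [Kc | ->] Nac; auto. congruence. }
  pose proof (Min r Kr); lia.
Qed.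

(** * Lines of a quad through a vertex *)

(** Some vertex of the line is at distance at most 1 from [z]: one of [p], [q], or else the vertex
    given by the triangle condition. *)
Lemma triangle_2 z p q r : adj p q -> adj q r -> adj p r -> d p z <= 2 -> d q z <= 2 ->
  d r z <= 2.
Proof.
  rewrite !(d_sym _ z). intros Apq Aqr Apr Hp Hq.
  pose proof (d_adj z p r Apr). pose proof (d_adj z q r Aqr).
  destruct (Nat.eq_dec (d z p) 2) as [Ep | Ep]; [|lia].
  destruct (Nat.eq_dec (d z q) 2) as [Eq | Eq]; [|lia].
  destruct (tc z p q 1 Apq Ep Eq) as (x & X1 & X2 & X3).
  destruct (classic (x = r)) as [-> | N]; [lia|].
  pose proof (line_unique p q x r Apq X1 X2 (adj_sym _ _ Apr) (adj_sym _ _ Aqr) N) as A.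
  pose proof (d_adj z x r A); lia.
Qed.

(* When [d u v = 2], the condition [d x v <= 2] on a neighbour [x] of [u] says
   that the line through [u] and [x] contains a neighbour of [v]. *)
Lemma near_point u v x : adj u x -> d u v = 2 -> d x v <= 2 ->
  exists r, adj u r /\ adj r v /\ (r = x \/ adj r x).
Proof.
  rewrite !(d_sym _ v). intros A Hu Hx. destruct (Nat.eq_dec (d v x) 2) as [E | E].
  - destruct (tc v u x 1 A Hu E) as (r & X1 & X2 & X3). apply d_1 in X3.
    exists r; repeat split; auto.
  - assert (E1 : d v x = 1).
    { pose proof (proj1 (d_0 v x)) as H. destruct (d v x) as [|[|?]]; [|reflexivity|lia].
      rewrite H in Hu by reflexivity. rewrite d_sym in Hu. apply d_1 in A; lia. }
    apply d_1 in E1. exists x; repeat split; auto.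
Qed.

(** Among neighbours of [u], equal or adjacent means on the same line through [u]. *)
Lemma line_trans u a e c : adj u a -> adj u e -> adj u c ->
  a = e \/ adj a e -> e = c \/ adj e c -> a = c \/ adj a c.
Proof.
  intros A1 A2 A3 [-> | H1] [<- | H2]; auto.
  destruct (classic (a = c)) as [-> | N]; [auto|].
  right. apply (line_unique u e); auto.
Qed.

Lemma no_third_common_neighbour p q u v : p <> q -> ~ adj p q ->
  adj p u -> adj q u -> adj p v -> adj q v -> ~ adj u v.
Proof. intros N NA P1 Q1 P2 Q2 A. apply NA. apply (line_unique u v); auto. Qed.

(** Let [r] be the neighbour of [v] on the line of [x]. If it were at distance 3 from [w], then [u],
    [v], [w] against [p], [q], [r] would be an isometric [K_{3,3}^-]. *)
Lemma lines_agree_common u v w p q x : d u v = 2 -> d u w = 2 ->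
  adj u p -> adj u q -> p <> q -> ~ adj p q ->
  adj p v -> adj q v -> adj p w -> adj q w ->
  adj u x -> d x v <= 2 -> d x w <= 2.
Proof.
  intros Huv Huw Aup Auq Npq NApq Apv Aqv Apw Aqw Aux Hx.
  destruct (near_point u v x Aux Huv Hx) as (r & R1 & R2 & R3).
  assert (Hr : d r w <= 2).
  2:{ destruct R3 as [<- | R3]; [exact Hr|].
      apply (triangle_2 w u r x); auto; lia. }
  destruct (le_lt_dec (d r w) 2) as [H | H]; [exact H | exfalso].
  assert (Hrw : d r w = 3).
  { apply d_1 in R1. pose proof (d_tri r u w). rewrite (d_sym r u) in *; lia. }
  assert (M1 : d p w = 1) by (apply d_1; auto).
  assert (M2 : d q w = 1) by (apply d_1; auto).
  assert (M3 : d r v = 1) by (apply d_1; auto).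
  assert (M4 : d p r = 2).
  { apply (d_2 _ _ u); auto. intros ->; lia.
    intro A. apply d_1 in A. pose proof (d_tri r p w). rewrite (d_sym r p) in *; lia. }
  assert (M5 : d q r = 2).
  { apply (d_2 _ _ u); auto. intros ->; lia.
    intro A. apply d_1 in A. pose proof (d_tri r q w). rewrite (d_sym r q) in *; lia. }
  assert (M6 : d v w = 2).
  { apply (d_2 _ _ p); auto. intros ->; lia.
    intro A. apply d_1 in A. pose proof (d_tri r v w). lia. }
  assert (M7 : d p q = 2) by (apply (d_2 _ _ u); auto).
  apply no_K33minus. exists u, v, w, p, q, r.
  rewrite !d_eq.
  repeat split; try assumption; try (apply d_1; auto; fail); rewrite d_sym; assumption.
Qed.

Lemma d_le_2 u v c : adj u c -> adj c v -> d u v <= 2.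
Proof. intros A B. apply d_1 in A, B. pose proof (d_tri u c v); lia. Qed.

Lemma d_2_square u v p q : adj u p -> adj u q -> p <> q -> ~ adj p q ->
  adj p v -> adj q v -> v <> u -> d u v = 2.
Proof.
  intros. apply (d_2 _ _ p); auto.
  apply (no_third_common_neighbour p q); auto.
Qed.

Lemma second_midpoint_d u v c : d u v = 2 -> adj u c -> adj c v ->
  exists e, e <> c /\ ~ adj e c /\ adj u e /\ adj e v.
Proof.
  intros H A B. destruct (second_midpoint u v c) as (e & E1 & E2 & E3); auto.
  { apply d_eq, H. }
  exists e; repeat split; auto.
  apply d_2_inv in H as (N & NA & _).
  apply (no_third_common_neighbour u v); auto.
Qed.

(** The line through [p] and [v] contains a neighbour [r] of [q']. A neighbour of [u] within 2 of
    [v] is within 2 of [r], and [lines_agree_common] passes from [r] to [w]. *)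
Lemma lines_agree_step u v w p q q' x : d u v = 2 -> d u w = 2 ->
  adj u p -> adj u q -> adj u q' -> p <> q' -> ~ adj p q' -> q = q' \/ adj q q' ->
  adj p v -> adj q v -> adj p w -> adj q' w ->
  adj u x -> d x v <= 2 -> d x w <= 2.
Proof.
  intros Huv Huw Aup Auq Auq' N NA Hq Apv Aqv Apw Aqw Aux Hx.
  assert (Hpq : d p q' = 2) by (apply (d_2 _ _ u); auto).
  assert (Hvq : d v q' <= 2).
  { destruct Hq as [<- | Hq]; [|apply (d_le_2 _ _ q); auto].
    apply d_1 in Aqv. rewrite d_sym; lia. }
  destruct (near_point p q' v Apv Hpq Hvq) as (r & R1 & R2 & R3).
  assert (Nru : r <> u).
  { intros ->. destruct R3 as [<- | R3]; [rewrite d_refl in Huv; lia|].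
    apply d_1 in R3; lia. }
  assert (Hur : d u r = 2) by (apply (d_2_square _ _ p q'); auto).
  apply (lines_agree_common u r w p q'); auto.
  destruct R3 as [-> | R3]; [exact Hx|].
  rewrite d_sym. apply (triangle_2 x p v r); auto.
  - apply (d_le_2 _ _ u); auto.
  - rewrite d_sym; exact Hx.
Qed.

(* A quad through [u] is determined by any two of its lines through [u]. *)
Lemma lines_agree u v w p q x : d u v = 2 -> d u w = 2 ->
  adj u p -> adj u q -> p <> q -> ~ adj p q ->
  d p v <= 2 -> d q v <= 2 -> d p w <= 2 -> d q w <= 2 ->
  adj u x -> d x v <= 2 -> d x w <= 2.
Proof.
  intros Huv Huw Aup Auq N NA Hpv Hqv Hpw Hqw Aux Hx.
  destruct (near_point u v p) as (p1 & P1 & P2 & P3); auto.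
  destruct (near_point u v q) as (q1 & Q1 & Q2 & Q3); auto.
  destruct (near_point u w p) as (p2 & P4 & P5 & P6); auto.
  destruct (near_point u w q) as (q2 & Q4 & Q5 & Q6); auto.
  assert (sym_line : forall a c, a = c \/ adj a c -> c = a \/ adj c a).
  { intros a c [-> | H]; auto. }
  assert (P : p1 = p2 \/ adj p1 p2) by (apply (line_trans u p1 p p2); auto).
  assert (Q : q1 = q2 \/ adj q1 q2) by (apply (line_trans u q1 q q2); auto).
  assert (X : ~ (p1 = q2 \/ adj p1 q2)).
  { intro H. destruct (line_trans u p p1 q2) as [E | E]; auto.
    - destruct (line_trans u p q2 q); subst; auto.
    - destruct (line_trans u p q2 q); auto. }
  assert (Y : ~ (q2 = p2 \/ adj q2 p2)).
  { intro H. apply X. apply sym_line. apply (line_trans u q2 p2 p1); auto. }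
  (* Through [t], opposite to [u] over [p1] and [q2], the passage from [v] to [w] changes one common
     neighbour at a time. *)
  destruct (second_midpoint_d p1 q2 u) as (t & T1 & T2 & T3 & T4); auto.
  { apply (d_2 _ _ u); auto. }
  assert (Hut : d u t = 2) by (apply (d_2_square _ _ p1 q2); auto).
  apply (lines_agree_step u t w q2 p1 p2); auto.
  apply (lines_agree_step u v t p1 q1 q2); auto.
Qed.

(* The quad of [u] and [v] seen from [u]: [u], the lines through [u] towards [v],
   and the vertices at distance 2 from [u] that have the same lines as [v]. *)
Definition quad (u v w : T) : Prop :=
  w = u \/ (adj u w /\ d w v <= 2) \/
  (d u w = 2 /\ forall x, adj u x -> (d x w <= 2 <-> d x v <= 2)).

Lemma quad_intro u v w p q : d u v = 2 -> d u w = 2 ->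
  adj u p -> adj u q -> p <> q -> ~ adj p q ->
  d p v <= 2 -> d q v <= 2 -> d p w <= 2 -> d q w <= 2 -> quad u v w.
Proof.
  intros. right; right; split; [assumption|].
  intros x Hx; split; apply (lines_agree u _ _ p q); auto.
Qed.

(** The quad is seen from the next corner of the square [u], [p], [v], [q]. For [w] at distance 2
    from [p], [quad_intro] needs only two lines through [p] that come near both [q] and [w]. *)
Lemma quad_rotate_sub u v p q w : d u v = 2 -> d p q = 2 ->
  adj u p -> adj p v -> adj u q -> adj q v -> quad u v w -> quad p q w.
Proof.
  intros Huv Hpq Aup Apv Auq Aqv Hw.
  apply d_2_inv in Huv as Huv'. destruct Huv' as (Nuv & NAuv & _).
  apply d_2_inv in Hpq as Hpq'. destruct Hpq' as (Npq & NApq & _).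
  assert (Huq : d u q <= 2) by (apply d_1 in Auq; lia).
  assert (Hvq : d v q <= 2) by (rewrite d_sym; apply d_1 in Aqv; lia).
  assert (Hpv : d p v <= 2) by (apply d_1 in Apv; lia).
  assert (Hqv : d q v <= 2) by (apply d_1 in Aqv; lia).
  destruct Hw as [-> | [[Auw Hwv] | [Huw Hw]]].
  - right; left; auto.
  - destruct (classic (w = p)) as [-> | Nwp]; [left; reflexivity|].
    assert (Hwq : d w q <= 2) by (apply (d_le_2 _ _ u); auto).
    destruct (classic (adj p w)) as [Apw | Apw]; [right; left; auto|].
    apply (quad_intro p q w u v); auto.
    + apply (d_2 _ _ u); auto.
    + apply d_1 in Auw; lia.
    + rewrite d_sym; exact Hwv.
  - assert (Hp : d p w <= 2) by (apply Hw; auto).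
    assert (Hq : d q w <= 2) by (apply Hw; auto).
    assert (Nwp : p <> w) by (intros ->; apply d_1 in Aup; lia).
    destruct (classic (adj p w)) as [Apw | Apw].
    { right; left; split; [exact Apw | rewrite d_sym; exact Hq]. }
    destruct (near_point u w q) as (r & R1 & R2 & R3); auto.
    assert (Nrp : p <> r) by (intros <-; auto).
    assert (NArp : ~ adj p r).
    { intro A. destruct (line_trans u p r q); auto. }
    (* The second line goes to [z], a neighbour of [r]: as [r] is adjacent to [w] and equal or
       adjacent to [q], [z] is within 2 of both. *)
    destruct (second_midpoint_d p r u) as (z & Z1 & Z2 & Z3 & Z4); auto.
    { apply (d_2 _ _ u); auto. }
    apply (quad_intro p q w u z); auto.
    + pose proof (proj1 (d_0 p w)). pose proof (proj1 (d_1 p w)).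
      destruct (d p w) as [|[|[|]]]; try lia; exfalso; auto.
    + destruct R3 as [-> | R3]; [apply d_1 in Z4; lia | apply (d_le_2 _ _ r); auto].
    + lia.
    + apply (d_le_2 _ _ r); auto.
Qed.

Lemma quad_rotate u v p q w : d u v = 2 -> d p q = 2 ->
  adj u p -> adj p v -> adj u q -> adj q v -> (quad u v w <-> quad p q w).
Proof.
  intros. split; apply quad_rotate_sub; auto.
Qed.

Lemma quad_congr u v v' w : d u v' = 2 ->
  (forall x, adj u x -> (d x v' <= 2 <-> d x v <= 2)) -> (quad u v w <-> quad u v' w).
Proof.
  intros H E. unfold quad. split; intros [-> | [[A B] | [A B]]]; auto; right.
  - left; split; [exact A | apply E; auto].
  - right; split; [exact A|]. intros x Hx. rewrite (B x Hx), (E x Hx); reflexivity.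
  - left; split; [exact A | apply E; auto].
  - right; split; [exact A|]. intros x Hx. rewrite (B x Hx), (E x Hx); reflexivity.
Qed.

(** A neighbour [w] of [u] is reached by one rotation around a square [u], [w], [t], [q], where [t]
    has the same lines as [v]; a vertex opposite to [u] by two rotations. *)
Lemma quad_rebase u v w : d u v = 2 -> quad u v w ->
  exists w', d w w' = 2 /\ forall y, quad u v y <-> quad w w' y.
Proof.
  intros Huv [-> | [[Auw Hwv] | [Huw Hw]]].
  - exists v; split; [exact Huv | reflexivity].
  (* Of two non-adjacent common neighbours of [u] and [v], at least one is off the line of [w]. *)
  - assert (E : exists q, adj u q /\ d q v <= 2 /\ w <> q /\ ~ adj w q).
    { apply d_2_inv in Huv as (N & NA & p & P1 & P2).
      destruct (second_midpoint_d u v p) as (p' & Q1 & Q2 & Q3 & Q4); auto.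
      { apply (d_2 _ _ p); auto. }
      assert (d p v <= 2 /\ d p' v <= 2) as [].
      { apply d_1 in P2, Q4; lia. }
      destruct (classic (w = p \/ adj w p)) as [H1 | H1].
      - exists p'; repeat split; auto.
        + intros ->. destruct H1; auto.
        + intro A. destruct (line_trans u p' w p); auto.
      - exists p; repeat split; auto. }
    destruct E as (q & Auq & Hqv & Nwq & NAwq).
    assert (Hwq : d w q = 2) by (apply (d_2 _ _ u); auto).
    destruct (second_midpoint_d w q u) as (t & T1 & T2 & T3 & T4); auto.
    assert (Hut : d u t = 2) by (apply (d_2_square _ _ w q); auto).
    exists q; split; [exact Hwq|]. intro y.
    rewrite <- (quad_rotate u t w q y); auto.
    apply quad_congr; auto.
    assert (d w t <= 2 /\ d q t <= 2) as [].
    { apply d_1 in T3, T4. rewrite (d_sym q); lia. }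
    intros x Hx; split; apply (lines_agree u _ _ w q); auto.
  - apply d_2_inv in Huw as H. destruct H as (N & NA & p & P1 & P2).
    destruct (second_midpoint_d u w p) as (q & Q1 & Q2 & Q3 & Q4); auto.
    assert (Hpq : d p q = 2) by (apply (d_2 _ _ u); auto).
    exists u; split; [rewrite d_sym; exact Huw|]. intro y.
    rewrite (quad_congr u v w y Huw Hw).
    rewrite (quad_rotate u w p q y), (quad_rotate p q w u y); auto; try reflexivity.
    rewrite d_sym; exact Huw.
Qed.

Lemma quad_diam u v x y : d u v = 2 -> quad u v x -> quad u v y -> d x y <= 2.
Proof.
  intros H Hx Hy. destruct (quad_rebase u v x H Hx) as (x' & Hx' & E).
  destruct (proj1 (E y) Hy) as [Ey | [[A _] | [A _]]].
  - rewrite Ey, d_refl; lia.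
  - apply d_1 in A; lia.
  - lia.
Qed.

Lemma quad_closed u v p q y : d u v = 2 -> quad u v p -> quad u v q -> p <> q ->
  adj y p -> adj y q -> quad u v y.
Proof.
  intros H Hp Hq N A B. destruct (quad_rebase u v p H Hp) as (p' & Hp' & E).
  apply E. destruct (proj1 (E q) Hq) as [Eq | [[C D] | [C D]]]; [congruence | |]; right; left.
  - split; [auto|]. apply (triangle_2 p' p q y); auto; lia.
  - split; [auto|]. apply D; auto. apply d_1 in B; lia.
Qed.

(* Local-to-global criterion for gatedness, for sets of diameter 2. *)
Lemma closed_gated (X : T -> Prop) s : X s ->
  (forall x y, X x -> X y -> d x y <= 2) ->
  (forall p q y, X p -> X q -> p <> q -> adj y p -> adj y q -> X y) -> gated adj X.
Proof.
  intros Ss Diam Closed x.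
  destruct (min_dist X x s Ss) as (g & Sg & Min).
  apply (gated_intro _ _ g Sg).
  (* Two adjacent vertices at minimal distance would have a nearer common neighbour by the triangle
     condition, and [Closed] puts it into [X]. *)
  assert (Step : forall y h, X y -> X h -> adj h y -> d x h = d x g -> d x y = S (d x g)).
  { intros y h Sy Sh A E. pose proof (d_adj x h y A). pose proof (Min y Sy).
    destruct (Nat.eq_dec (d x y) (d x h)) as [E' | E']; [exfalso | lia].
    destruct (d x g) as [|k] eqn:Eg.
    { assert (h = y) by (apply eq_trans with x; [symmetry|]; apply d_0; lia).
      subst; eapply adj_irr; exact A. }
    destruct (tc x h y k A) as (r & R1 & R2 & R3); [lia | lia|].
    assert (Sr : X r).
    { apply (Closed h y); auto. intros ->; eapply adj_irr; exact A. }
    pose proof (Min r Sr); lia. }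
  intros y Sy.
  pose proof (Diam g y Sg Sy).
  destruct (d g y) as [|[|[|]]] eqn:Egy; [| | |lia].
  - apply d_0 in Egy as <-; lia.
  - apply d_1 in Egy. rewrite (Step y g); auto; lia.
  - apply d_2_inv in Egy as Egy'. destruct Egy' as (N & NA & t & T1 & T2).
    assert (St : X t) by (apply (Closed g y); auto).
    pose proof (Step t g St Sg T1 eq_refl) as Et.
    pose proof (d_adj x t y T2). pose proof (Min y Sy).
    (* Only [d x g + 2] remains for [d x y]. The value [d x g] is excluded by the quadrangle
       condition below [t]; for [d x g + 1] the triangle condition gives a vertex [z] of [X] at
       minimal distance, and the quadrangle condition applies to [z] and [g]. *)
    destruct (Nat.eq_dec (d x y) (d x g)) as [E | E]; [exfalso|].
    { destruct (d x g) as [|k] eqn:Eg.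
      { apply d_0 in Eg, E. congruence. }
      destruct (qc x g y t k) as (r & R1 & R2 & R3); auto.
      assert (Sr : X r) by (apply (Closed g y); auto).
      pose proof (Min r Sr); lia. }
    destruct (Nat.eq_dec (d x y) (S (d x g))) as [E' | E']; [exfalso | lia].
    destruct (tc x t y (d x g) T2 Et E') as (z & Z1 & Z2 & Z3).
    assert (Sz : X z).
    { apply (Closed t y); auto. intros ->; eapply adj_irr; exact T2. }
    assert (Nzg : z <> g) by (intros ->; auto).
    destruct (d x g) as [|k] eqn:Eg.
    { apply d_0 in Eg, Z3. congruence. }
    destruct (qc x z g t k) as (r & R1 & R2 & R3); auto.
    assert (Sr : X r) by (apply (Closed z g); auto).
    pose proof (Min r Sr); lia.
Qed.

(** * Gates of quads and gated hulls *)

Lemma quad_gated u v : d u v = 2 -> gated adj (quad u v).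
Proof.
  intro H. apply (closed_gated _ u).
  - left; reflexivity.
  - intros x y; apply quad_diam, H.
  - intros p q y; apply quad_closed, H.
Qed.

(** A gate of [y] other than [y] itself would coincide with both [p] and [q]. *)
Lemma gated_closed S p q y : gated adj S -> S p -> S q -> p <> q ->
  adj y p -> adj y q -> S y.
Proof.
  intros G Sp Sq N A B. destruct (gated_gate S y G) as (g & Sg & Hg).
  pose proof (Hg p Sp) as Ep. pose proof (Hg q Sq) as Eq.
  apply d_1 in A, B.
  destruct (d y g) as [|k] eqn:E.
  - apply d_0 in E as ->; exact Sg.
  - exfalso; apply N. apply eq_trans with g; [symmetry|]; apply d_0; lia.
Qed.

Lemma quad_right u v : d u v = 2 -> quad u v v.
Proof. intro H; right; right; split; [exact H | reflexivity]. Qed.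

Lemma quad_midpoint u v c : adj u c -> adj c v -> quad u v c.
Proof. intros A B; right; left; split; [exact A|]. apply d_1 in B; lia. Qed.

(** Gated sets are closed under common neighbours, and these generate the quad: first the common
    neighbours of [u] and [v], then the lines from [u] to them, then the vertices opposite to
    [u]. *)
Lemma quads_are_hulls : A34 adj.
Proof.
  intros u v H. apply d_eq in H. exists (quad u v).
  split; [split; [apply quad_gated, H | split]|].
  - intros x [-> | ->]; [left; reflexivity | apply quad_right, H].
  - intros S G HS.
    assert (Su : S u) by (apply HS; auto). assert (Sv : S v) by (apply HS; auto).
    apply d_2_inv in H as H'. destruct H' as (N & NA & p & P1 & P2).
    assert (Line : forall w, adj u w -> d w v <= 2 -> S w).
    { intros w A B. destruct (near_point u v w A H B) as (r & R1 & R2 & R3).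
      assert (Sr : S r) by (apply (gated_closed S u v r); auto).
      destruct R3 as [<- | R3]; [exact Sr|].
      apply (gated_closed S u r w); auto. intros ->; eapply adj_irr; exact R1. }
    intros w [-> | [[A B] | [A B]]]; [exact Su | auto|].
    destruct (second_midpoint_d u v p) as (q & Q1 & Q2 & Q3 & Q4); auto.
    assert (d p v <= 2 /\ d q v <= 2) as [].
    { apply d_1 in P2, Q4; lia. }
    assert (Hp : d p w <= 2) by (apply B; auto).
    assert (Hq : d q w <= 2) by (apply B; auto).
    destruct (near_point u w p P1 A Hp) as (r & R1 & R2 & R3).
    destruct (near_point u w q Q3 A Hq) as (r' & R4 & R5 & R6).
    assert (Onl : forall a c, adj u a -> adj u c -> (c = a \/ adj c a) -> d a v <= 2 -> S c).
    { intros a c Ha Hc [-> | Hac] D; auto.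
      apply Line; auto. apply (triangle_2 v u a c); auto; lia. }
    apply (gated_closed S r r' w); auto.
    + apply (Onl p); auto.
    + apply (Onl q); auto.
    + intros <-. destruct (line_trans u q r p); auto.
      destruct R6 as [-> | ?]; auto.
  - split.
    + intros x y Hx Hy. exists (d x y); split; [eapply quad_diam; eassumption | apply d_spec].
    + exists u, v. split; [left; reflexivity | split; [apply quad_right, H | apply d_eq, H]].
Qed.

(** * Antipodal exchange and finiteness *)

(** Let [w] be a neighbour of [v] towards [x]; induction gives [y'] next to [w]. In the quad of [v]
    and [y'] the gates of [u] and [x] are [y'] and [w], so the vertex [y] opposite to [w] has the
    required distances. *)
Lemma antipodal_step n u v x : d u v = S (S n) -> adj u x -> d x v = S n ->
  exists y, adj v y /\ d u y = S n /\ d x y = S (S n).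
Proof.
  revert u v x; induction n as [|n IH]; intros u v x Huv Aux Hxv.
  - apply d_1 in Hxv. destruct (second_midpoint_d u v x) as (y & Y1 & Y2 & Y3 & Y4); auto.
    exists y; repeat split; auto.
    + apply d_1; exact Y3.
    + apply (d_2 _ _ u); auto.
  - destruct (d_step v x (S n)) as (w & W1 & W2); [rewrite d_sym; exact Hxv|].
    rewrite d_sym in W2.
    assert (Huw : d u w = S (S n)).
    { apply d_1 in Aux, W1. pose proof (d_tri u x w). pose proof (d_tri u w v).
      rewrite (d_sym w v) in *; lia. }
    destruct (IH u w x Huw Aux W2) as (y' & Y1 & Y2 & Y3).
    assert (Hvy : d v y' = 2).
    { pose proof (d_le_2 v y' w W1 Y1). pose proof (d_tri u y' v).
      rewrite (d_sym y' v) in *; lia. }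
    destruct (second_midpoint_d v y' w) as (y & Z1 & Z2 & Z3 & Z4); auto.
    assert (Hwy : d w y = 2) by (apply (d_2 _ _ v); auto).
    pose proof (quad_gated v y' Hvy) as G.
    assert (Q1 : quad v y' v) by (left; reflexivity).
    assert (Q2 : quad v y' y') by (apply quad_right, Hvy).
    assert (Q3 : quad v y' w) by (apply quad_midpoint; auto).
    assert (Q4 : quad v y' y) by (apply quad_midpoint; auto).
    destruct (gated_gate _ x G) as (g & Qg & Hg).
    destruct (gated_gate _ u G) as (h & Qh & Hh).
    pose proof (Hg v Q1). pose proof (Hg y' Q2). pose proof (Hg w Q3). pose proof (Hg y Q4).
    pose proof (Hh v Q1). pose proof (Hh y' Q2). pose proof (Hh y Q4).
    pose proof (Hh g Qg).
    pose proof (quad_diam v y' h v Hvy Qh Q1).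
    (* The gate [h] of [u] is within 2 of [v], and [d u v] exceeds [d u y'] by 2. *)
    assert (h = y') as -> by (apply d_0; lia).
    pose proof (d_tri u x g). apply d_1 in Aux.
    pose proof (d_tri g w v). pose proof (d_tri g w y').
    rewrite (d_sym y' g) in *.
    apply d_1 in W1, Y1, Z3, Z4. rewrite (d_sym v w) in *.
    (* A gate of [x] nearer than [w] would be at distance [n] from [x] and 2 from [y'], hence, [y']
       being the gate of [u], at distance [n + 3] from the neighbour [u] of [x]. *)
    assert (g = w) as -> by (apply d_0; pose proof (quad_diam v y' g v Hvy Qg Q1); lia).
    exists y. split; [apply d_1; exact Z3|]. rewrite (d_sym y y') in *. split; lia.
Qed.

Lemma antipodal_exchange : A5 adj.
Proof.
  intros u v x n NA D Aux I. apply d_eq in D. apply interval_d in I.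
  apply d_1 in Aux as E. rewrite E, D in I.
  destruct n as [|[|n]].
  - lia.
  - exfalso; apply NA, d_1, D.
  - destruct (antipodal_step n u v x D Aux) as (y & Y1 & Y2 & Y3); [lia|].
    apply d_1 in Y1 as E'.
    exists y, (S n). rewrite interval_d, !d_eq.
    repeat split; auto; try lia. rewrite (d_sym y v); lia.
Qed.

(** First steps from [u] towards the neighbour [y] of [v] also lead towards [v]; the step to [x] is
    a further one, since it leads away from [y]. *)
Lemma many_first_steps n u v : d u v = n ->
  exists l, NoDup l /\ length l = n /\ forall x, In x l -> adj u x /\ S (d x v) = n.
Proof.
  revert v; induction n as [|[|n] IH]; intros v H.
  - exists []; repeat split; [constructor | destruct H0 | destruct H0].
  - apply d_1 in H. exists [v]. split; [repeat constructor; intros [] | split; [reflexivity|]].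
    intros x [<- | []]. rewrite d_refl; auto.
  - destruct (d_step u v (S n) H) as (x & Aux & Hx).
    destruct (antipodal_step n u v x H Aux Hx) as (y & Y1 & Y2 & Y3).
    destruct (IH y Y2) as (l & L1 & L2 & L3).
    exists (x :: l). split; [|split; [simpl; congruence|]].
    + constructor; [|exact L1]. intro Hin. apply L3 in Hin; lia.
    + intros z [<- | Hz]; [split; [exact Aux | lia]|].
      apply L3 in Hz as [A E]. split; [exact A|].
      apply d_1 in A, Y1. pose proof (d_tri z y v). pose proof (d_tri u z v).
      rewrite (d_sym y v) in *; lia.
Qed.

Lemma ball_finite u n : locally_finite adj -> exists l, forall v, d u v <= n -> In v l.
Proof.
  intro F. induction n as [|n [l Hl]].
  - exists [u]. intros v Hv. left. apply d_0; lia.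
  - assert (E : exists l', forall x y, In x l -> adj x y -> In y l').
    { clear Hl. induction l as [|x l [l' IH]].
      - exists []. intros x y [].
      - destruct (F x) as [k Hk]. exists (k ++ l').
        intros z y [<- | Hz] A; apply in_or_app; eauto. }
    destruct E as [l' Hl']. exists (u :: l'). intros v Hv.
    destruct (d v u) as [|k] eqn:E.
    + left. apply d_0 in E; auto.
    + right. destruct (d_step v u k E) as (w & A & Ew).
      apply (Hl' w); auto. apply Hl. rewrite (d_sym u w), (d_sym u v) in *; lia.
Qed.

Lemma locally_finite_finite (u : T) : locally_finite adj -> exists l, forall v : T, In v l.
Proof.
  intro F. destruct (F u) as [k Hk].
  destruct (ball_finite u (length k) F) as [l Hl].
  exists l. intro v. apply Hl.
  destruct (many_first_steps (d u v) u v eq_refl) as (m & M1 & M2 & M3).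
  rewrite <- M2. apply NoDup_incl_length; [exact M1|].
  intros x Hx. apply Hk, M3, Hx.
Qed.

End DualPolar.

(** * From the local conditions to the theorem *)

Section LocallyDualPolar.

Variable T : Type.
Variable adj : T -> T -> Prop.
Hypothesis graph : is_graph adj.
Hypothesis local : locally_dual_polar adj.

Lemma graph_sym x y : adj x y -> adj y x.
Proof. apply graph. Qed.

Lemma graph_irr x : ~ adj x x.
Proof. apply graph. Qed.

Lemma local_line_unique x y a c :
  adj x y -> adj a x -> adj a y -> adj c x -> adj c y -> a <> c -> adj a c.
Proof.
  intros Axy Aax Aay Acx Acy N. apply NNPP; intro NA.
  destruct local as (_ & _ & K4 & _). apply K4. exists x, y, a, c.
  repeat split; auto using graph_sym; intros ->; eapply graph_irr; eauto.
Qed.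

Lemma local_triangle u v w p q : adj v w -> u <> v -> u <> w ->
  ~ adj u v -> ~ adj u w -> adj u p -> adj p v -> adj u q -> adj q w ->
  exists x, adj x u /\ adj x v /\ adj x w.
Proof.
  intros. destruct local as (_ & L & _). apply (proj1 (L u)); auto; apply dist_is_2; eauto.
Qed.

Lemma local_quadrangle u v w z p q : adj z v -> adj z w -> v <> w -> ~ adj v w ->
  u <> v -> ~ adj u v -> u <> w -> ~ adj u w ->
  adj u p -> adj p v -> adj u q -> adj q w ->
  u <> z -> ~ adj u z -> (forall c, adj u c -> adj c z -> False) ->
  exists x, adj x u /\ adj x v /\ adj x w.
Proof.
  intros. destruct local as (_ & L & _). apply (proj2 (L u) v w z); auto.
  - apply dist_is_2; repeat split; auto. exists z; auto using graph_sym.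
  - apply dist_is_2; eauto.
  - apply dist_is_2; eauto.
  - apply dist_is_3; repeat split; auto. exists p, v; auto using graph_sym.
Qed.

Lemma interval_dist_2 u v x : dist_is adj u v 2 -> in_interval adj u v x ->
  x = u \/ x = v \/ (adj u x /\ adj x v).
Proof.
  intros D (a & c & H1 & H2 & H3).
  pose proof (dist_is_unique _ _ _ _ _ _ D H3) as E.
  destruct a as [|[|[|a]]]; [| | |lia].
  - apply dist_is_0 in H1; auto.
  - injection E as <-. apply (dist_is_1 _ _ graph_irr) in H1, H2; auto.
  - injection E as E. destruct c; [|discriminate]. apply dist_is_0 in H2; auto.
Qed.

(** The interval consists of [u], [v] and their common neighbours. Since [u] and [v] are not
    adjacent, some opposite pair of the 4-cycle consists of common neighbours, and one of the two is
    not [c]. *)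
Lemma local_second_midpoint u v c : dist_is adj u v 2 -> adj u c -> adj c v ->
  exists e, e <> c /\ adj u e /\ adj e v.
Proof.
  intros D Auc Acv. destruct local as (Th & _).
  destruct (Th u v D) as (x & y & z & w &
    (Nxy & Nxz & Nxw & Nyz & Nyw & Nzw & Axy & Ayz & Azw & Awx & NAxz & NAyw) & I1 & I2 & I3 & I4).
  apply (interval_dist_2 _ _ _ D) in I1, I2, I3, I4.
  assert (G : forall e f, e <> f -> adj u e -> adj e v -> adj u f -> adj f v ->
    exists e, e <> c /\ adj u e /\ adj e v).
  { intros e f N ? ? ? ?. destruct (classic (e = c)) as [-> | Nc]; eauto. }
  apply dist_is_2 in D as (Nuv & NAuv & _).
  pose proof graph_sym as Sy.
  destruct I1 as [E1 | [E1 | [? ?]]], I3 as [E3 | [E3 | [? ?]]];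
    try (exfalso; subst; auto; fail); try (eapply (G x z); assumption);
  destruct I2 as [E2 | [E2 | [? ?]]], I4 as [E4 | [E4 | [? ?]]];
    try (exfalso; subst; auto; fail); apply (G y w); assumption.
Qed.

End LocallyDualPolar.

Theorem theorem5p3 (T : Type) (adj : T -> T -> Prop) (b : T) :
  is_graph adj -> locally_dual_polar adj ->
  dual_polar (@cover_adj T adj b) /\
  (locally_finite adj ->
     exists l : list (cover_vertex adj b), forall S, In S l).
Proof.
  intros G L.
  pose proof (graph_sym _ _ G) as sym. pose proof (graph_irr _ _ G) as irr.
  pose proof (local_line_unique _ _ G L) as line.
  pose proof (local_triangle _ _ L) as ltc.
  pose proof (local_quadrangle _ _ G L) as lqc.
  pose proof (cover_is_graph _ _ sym irr line ltc lqc b) as CG.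
  pose proof (proj1 CG) as csym. pose proof (proj1 (proj2 CG)) as cirr.
  pose proof (proj2 (proj2 CG)) as cconn.
  pose proof (cover_line_unique _ _ sym line b) as cline.
  pose proof (cover_triangle_condition _ _ sym irr line ltc lqc b) as ctc.
  pose proof (cover_quadrangle_condition _ _ sym irr line ltc lqc b) as cqc.
  pose proof (cover_thick _ _ sym irr line b (local_second_midpoint _ _ G L)) as cmid.
  assert (cK33 : no_isometric_K33minus (@cover_adj T adj b)).
  { apply cover_no_isometric_K33minus; auto. apply L. }
  split; [split; [exact CG | split; [|split]]|].
  - apply maximal_cliques_gated; auto.
  - apply quads_are_hulls; auto.
  - apply antipodal_exchange; auto.
  - intro F.
    (* The class of the trivial walk is the vertex from which distances are bounded. *)
    destruct (cover_of_walk T adj b [b]) as [S _]; [constructor | reflexivity|].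
    apply (locally_finite_finite _ (@cover_adj T adj b)); auto.
    apply cover_locally_finite; auto.
Qed.
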